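(* Let $J\in\mathbb{C}^{2\times2}$ be unitary and let $G$ be the associated Green's function and $\Psi(t,x;F)$ the corresponding wave function with initial datum $F$ (both defined in the context). Let $(F_n)_n$, $n\in\mathbb{N}_0$, be a superoscillating sequence (defined in the context), $F_n(x)=\sum_{j=0}^n c_j(n)e^{ik_j(n)x}$, with limit frequency $k\in\mathbb{R}$, and assume in addition that the entire extensions $F_n(z)=\sum_{j=0}^n c_j(n)e^{ik_j(n)z}$, $z\in\mathbb{C}$, satisfy $$\lim_{n\to\infty}\ \sup_{z\in\mathbb{C}}\big|F_n(z)-e^{ikz}\big|e^{-C|z|}=0$$ for some $C\geq0$. Then also $$\lim_{n\to\infty}\Psi(t,x;F_n)=\Psi(t,x;e^{ik\,\cdot\,}),$$ uniformly on compact subsets of $(0,\infty)\times\mathbb{R}$; that is, for every compact $K\subset(0,\infty)\times\mathbb{R}$, $\sup_{(t,x)\in K,\,x\neq0}|\Psi(t,x;F_n)-\Psi(t,x;e^{ik\,\cdot\,})|\to0$ as $n\to\infty$.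
   Context: Superoscillations: a generalized Fourier sequence is a sequence of functions $(F_n)_n$, $n\in\mathbb{N}_0$, of the form $F_n(x)=\sum_{j=0}^n c_j(n)e^{ik_j(n)x}$, $x\in\mathbb{R}$, with $k_j(n)\in\mathbb{R}$, $c_j(n)\in\mathbb{C}$, $j\in\{0,\dots,n\}$. It is superoscillating (with limit frequency $k$) if (i) there is $k\in\mathbb{R}$ with $\sup_{n\in\mathbb{N}_0,\,j\in\{0,\dots,n\}}|k_j(n)|<|k|$, and (ii) there is a compact subset $K\subset\mathbb{R}$ with $\lim_{n\to\infty}\sup_{x\in K}|F_n(x)-e^{ikx}|=0$. Conventions: for $t>0$, $\sqrt{it}=e^{i\pi/4}\sqrt t$ and $\sqrt{i\pi t}=e^{i\pi/4}\sqrt{\pi t}$ (principal branch); $\Theta(x)=1$ for $x>0$ and $\Theta(x)=0$ for $x<0$. The entire function $\Lambda$ is $\Lambda(z)=e^{z^2}(1-\operatorname{erf}(z))$, where $\operatorname{erf}(z)=\frac{2}{\sqrt\pi}\int_0^z e^{-\xi^2}d\xi$. Coefficients. Every unitary $J\in\mathbb{C}^{2\times2}$ has the form $J=e^{i\phi}\begin{pmatrix}\alpha&-\bar\beta\\ \beta&\bar\alpha\end{pmatrix}$ with $\phi\in[0,\pi)$, $\alpha,\beta\in\mathbb{C}$ and $|\alpha|^2+|\beta|^2=1$. For $x,y\in\mathbb{R}\setminus\{0\}$ put $\eta^{(x,y)}=0$ if $|\operatorname{Re}(\alpha)|=1$, and if $|\operatorname{Re}(\alpha)|\neq1$ put $$\eta^{(x,y)}=\frac{1}{\sqrt{1-\operatorname{Re}(\alpha)^2}}\cdot\begin{cases}-\operatorname{Im}(\alpha),&x,y>0,\\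 -i\bar\beta,&x>0,\,y<0,\\ i\beta,&x<0,\,y>0,\\ \operatorname{Im}(\alpha),&x,y<0.\end{cases}$$ Case I: if $\operatorname{Re}(\alpha)\neq-\cos(\phi)$, then $\omega_\pm=\frac{-\sin(\phi)\pm\sqrt{1-\operatorname{Re}(\alpha)^2}}{\cos(\phi)+\operatorname{Re}(\alpha)}$, $\mu_\pm^{(x,y)}=-\frac{\omega_\pm}{2}\big(\Theta(xy)\pm\eta^{(x,y)}\big)$, $\mu_0^{(x,y)}=\operatorname{sgn}(xy)$. Case II: if $\operatorname{Re}(\alpha)=-\cos(\phi)\neq-1$, then $\omega_-=\mu_-^{(x,y)}=0$, $\omega_+=\cot(\phi)$, $\mu_+^{(x,y)}=-\frac{\omega_+}{2}\big(\Theta(xy)+\eta^{(x,y)}\big)$, $\mu_0^{(x,y)}=\eta^{(x,y)}-\Theta(-xy)$. Case III: if $\operatorname{Re}(\alpha)=-\cos(\phi)=-1$, then $\omega_\pm=\mu_\pm^{(x,y)}=0$ and $\mu_0^{(x,y)}=-1$. Green's function: for $t>0$, $x,y\in\mathbb{R}\setminus\{0\}$, $$G(t,x,y)=\Big(\mu_+^{(x,y)}\Lambda\Big(\tfrac{|x|+|y|}{2\sqrt{it}}+\omega_+\sqrt{it}\Big)+\mu_-^{(x,y)}\Lambda\Big(\tfrac{|x|+|y|}{2\sqrt{it}}+\omega_-\sqrt{it}\Big)\Big)e^{-\frac{(|x|+|y|)^2}{4it}}+\frac{1}{2\sqrt{i\pi t}}\Big(\mu_0^{(x,y)}e^{-\frac{(|x|+|y|)^2}{4it}}+e^{-\frac{(x-y)^2}{4it}}\Big).$$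 Wave function: for $t>0$, $x\in\mathbb{R}\setminus\{0\}$ and $F$ entire with $|F(z)|\le Ae^{B|\operatorname{Im}(z)|}$ for all $z\in\mathbb{C}$ and some $A,B\geq0$, $$\Psi(t,x;F)=\int_{\mathbb{R}}G(t,x,y)F(y)\,dy:=\lim_{R_1\to\infty}\int_{-R_1}^0G(t,x,y)F(y)\,dy+\lim_{R_2\to\infty}\int_0^{R_2}G(t,x,y)F(y)\,dy$$ (improper Riemann integrals, which exist for such $F$). It is the solution of $i\partial_t\Psi=-\partial_x^2\Psi$ on $x\neq0$ with jump condition $(I-J)(\Psi(t,0^+),\Psi(t,0^-))^T=i(I+J)(\partial_x\Psi(t,0^+),-\partial_x\Psi(t,0^-))^T$ and initial value $\Psi(0^+,x)=F(x)$ considered in the paper. The notation $e^{ik\,\cdot\,}$ means the function $z\mapsto e^{ikz}$. *)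

(* Defs.v *)
(* Stdlib reals with Coquelicot: complex numbers [C], Riemann integrals of
   [C]-valued functions, suprema in [Rbar]. *)
From Stdlib Require Export Reals List.
From Coquelicot Require Export Coquelicot.
Open Scope R_scope.

(** * Topology and suprema *)

(* Open covers; Stdlib's [compact] only covers subsets of [R]. *)
Definition compact_set {T : UniformSpace} (K : T -> Prop) : Prop :=
  forall (I : Type) (U : I -> T -> Prop),
    (forall i, open (U i)) ->
    (forall x, K x -> exists i, U i x) ->
    exists l : list I, forall x, K x -> exists i, In i l /\ U i x.

Definition sup_on {T : Type} (D : T -> Prop) (f : T -> R) : Rbar :=
  Lub_Rbar (fun r => exists x, D x /\ r = f x).

(* [lim_n sup_D (f n) = 0], for nonnegative [f n].  The supremum may be [p_infty]
   for some [n]; over an empty [D] it is [m_infty], so the condition holds, in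
   agreement with the convention that such a supremum of nonnegative
   quantities is 0. *)
Definition sup_tends_to_0 {T : Type} (D : T -> Prop) (f : nat -> T -> R) : Prop :=
  forall eps : posreal,
    eventually (fun n => Rbar_lt (sup_on D (f n)) (Finite eps)).

(** * Complex functions *)

Definition Cexp (z : C) : C := (exp (Re z) * cos (Im z), exp (Re z) * sin (Im z)).

(* The integral from 0 to [z] is taken along the segment [s |-> s z], [0 <= s <= 1]. *)
Definition Cerf (z : C) : C :=
  (RtoC (2 / sqrt PI)
   * RInt (V := C_R_CompleteNormedModule)
       (fun s : R => (Cexp (- (RtoC s * z) ^ 2) * z)%C) 0 1)%C.

Definition Lambda (z : C) : C := (Cexp (z ^ 2) * (1 - Cerf z))%C.

(* Principal branch of [sqrt (i a)] for [a > 0]. *)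
Definition sqrt_i (a : R) : C := (Cexp (Ci * RtoC (PI / 4)) * RtoC (sqrt a))%C.

Definition Theta (x : R) : R := if Rlt_dec 0 x then 1 else 0.

Definition cot (x : R) : R := cos x / sin x.

(** * Unitary 2x2 matrices *)

Definition adjoint (J : @matrix C 2 2) : @matrix C 2 2 :=
  mk_matrix 2 2 (fun i j => Cconj (coeff_mat (RtoC 0) J j i)).

Definition unitary (J : @matrix C 2 2) : Prop :=
  @Mmult C_Ring 2 2 2 (adjoint J) J = @Mone C_Ring 2
  /\ @Mmult C_Ring 2 2 2 J (adjoint J) = @Mone C_Ring 2.

(* Every unitary matrix has exactly one such triple [(phi, alpha, beta)]. *)
Definition unitary_param (J : @matrix C 2 2) (phi : R) (alpha beta : C) : Prop :=
  0 <= phi < PI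
  /\ Cmod alpha ^ 2 + Cmod beta ^ 2 = 1
  /\ J = mk_matrix 2 2 (fun i j =>
           match i, j with
           | 0%nat, 0%nat => Cexp (Ci * RtoC phi) * alpha
           | 0%nat, _     => Cexp (Ci * RtoC phi) * - Cconj beta
           | _,     0%nat => Cexp (Ci * RtoC phi) * beta
           | _,     _     => Cexp (Ci * RtoC phi) * Cconj alpha
           end)%C.

(** * Coefficients of the Green's function *)

(* In this section [x] and [y] are meant to be nonzero; the values on the axes
   are irrelevant. *)

Definition eta (alpha beta : C) (x y : R) : C :=
  if Req_dec_T (Rabs (Re alpha)) 1 then RtoC 0
  else
    (RtoC (1 / sqrt (1 - Re alpha ^ 2))
     * (if Rlt_dec 0 x
        then if Rlt_dec 0 y then RtoC (- Im alpha) else - Ci * Cconj beta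
        else if Rlt_dec 0 y then Ci * beta else RtoC (Im alpha)))%C.

Inductive coeff_case : Set := CaseI | CaseII | CaseIII.

Definition case_of (phi : R) (alpha : C) : coeff_case :=
  if Req_dec_T (Re alpha) (- cos phi)
  then if Req_dec_T (Re alpha) (-1) then CaseIII else CaseII
  else CaseI.

Definition omega_plus (phi : R) (alpha : C) : R :=
  match case_of phi alpha with
  | CaseI   => (- sin phi + sqrt (1 - Re alpha ^ 2)) / (cos phi + Re alpha)
  | CaseII  => cot phi
  | CaseIII => 0
  end.

Definition omega_minus (phi : R) (alpha : C) : R :=
  match case_of phi alpha with
  | CaseI   => (- sin phi - sqrt (1 - Re alpha ^ 2)) / (cos phi + Re alpha)
  | CaseII  => 0
  | CaseIII => 0
  end.

Definition mu_plus (phi : R) (alpha beta : C) (x y : R) : C :=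
  match case_of phi alpha with
  | CaseI | CaseII =>
      (RtoC (- (omega_plus phi alpha / 2))
       * (RtoC (Theta (x * y)) + eta alpha beta x y))%C
  | CaseIII => RtoC 0
  end.

Definition mu_minus (phi : R) (alpha beta : C) (x y : R) : C :=
  match case_of phi alpha with
  | CaseI =>
      (RtoC (- (omega_minus phi alpha / 2))
       * (RtoC (Theta (x * y)) - eta alpha beta x y))%C
  | CaseII | CaseIII => RtoC 0
  end.

Definition mu_0 (phi : R) (alpha beta : C) (x y : R) : C :=
  match case_of phi alpha with
  | CaseI   => RtoC (sign (x * y))
  | CaseII  => (eta alpha beta x y - RtoC (Theta (- (x * y))))%C
  | CaseIII => RtoC (-1)
  end.

(** * Green's function and wave function *)

Definition Green (phi : R) (alpha beta : C) (t x y : R) : C :=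
  let r := Rabs x + Rabs y in
  let gauss (s : R) := Cexp (- (RtoC (s ^ 2) / (4 * Ci * RtoC t))) in
  let Lam (w : R) := Lambda (RtoC r / (2 * sqrt_i t) + RtoC w * sqrt_i t) in
  ((mu_plus phi alpha beta x y * Lam (omega_plus phi alpha)
    + mu_minus phi alpha beta x y * Lam (omega_minus phi alpha)) * gauss r
   + 1 / (2 * sqrt_i (PI * t))
     * (mu_0 phi alpha beta x y * gauss r + gauss (x - y)%R))%C.

(* Sum of two improper Riemann integrals, over [(-oo, 0]] and [[0, +oo)]. *)
Definition Psi (phi : R) (alpha beta : C) (t x : R) (F : C -> C) : C :=
  let f (y : R) : C := (Green phi alpha beta t x y * F (RtoC y))%C in
  (RInt_gen (V := C_R_CompleteNormedModule) f (Rbar_locally m_infty) (at_point 0)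
   + RInt_gen (V := C_R_CompleteNormedModule) f (at_point 0) (Rbar_locally p_infty))%C.

(** * Superoscillations *)

Definition plane_wave (k : R) (z : C) : C := Cexp (Ci * RtoC k * z).

(* [c n j] and [kk n j] are the coefficients and frequencies; only [j <= n] matters. *)
Definition Fourier_seq (c : nat -> nat -> C) (kk : nat -> nat -> R)
    (n : nat) (z : C) : C :=
  @sum_n C_AbelianMonoid (fun j => (c n j * plane_wave (kk n j) z)%C) n.

Definition superoscillating (c : nat -> nat -> C) (kk : nat -> nat -> R)
    (k : R) : Prop :=
  Rbar_lt
    (sup_on (fun nj : nat * nat => (snd nj <= fst nj)%nat)
            (fun nj => Rabs (kk (fst nj) (snd nj))))
    (Finite (Rabs k))
  /\ exists K : R -> Prop, compact K /\
       sup_tends_to_0 K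
         (fun n x => Cmod (Fourier_seq c kk n (RtoC x) - plane_wave k (RtoC x))).

(* Main.v *)
Require Import Defs.
From Stdlib Require Import Lra Psatz.

(** The wave function is continuous in its initial datum for the weighted
    norm [sup_z |F z| exp (- B |z|)], locally uniformly in [(t, x)], and the
    hypothesis says that [F_n] tends to the plane wave in that norm.

    On each half-line [y > 0], [y < 0] the Green's function is the restriction
    of an entire function of [y].  On the real axis it only oscillates, like
    [exp (i y^2 / 4t)], but on the ray [(1 + i) s] it decays like
    [exp (- s^2 / 2t)], and between the two it is of size
    [exp (- Re z Im z / 2t)] up to a factor exponential in [Im z].  The integral of
    [G F] over the half-line therefore equals the integral over the ray:
    the difference of the two truncated integrals is the integral over
    a vertical side [R + i s], [0 <= s <= R], which tends to 0 when
    [F] is bounded by [A exp (p |Im z|)], as exponential sums with real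
    frequencies are ([half_line_limit]).  On the ray the Gaussian factor absorbs any
    growth [exp (B |z|)], so the integral is at most a constant times the
    weighted norm of [F].  This is applied to [F_n] and to the plane wave, to
    know that both improper integrals exist, and to their difference, to bound it
    ([Psi_continuous_dependence]).  A compact subset of the open half-plane lies in some
    [1/N <= t <= N], [|x| <= N] ([compact_half_plane_bounds]), where all constants are uniform.

    Two analytic facts support this.  Contour deformation is needed for entire functions
    and line segments only, and follows from one statement: the
    integral along the segment from 0 to [z] is a primitive of an entire function
    ([holo_segment_primitive]); this also shows that [Cerf], defined by such an
    integral, is entire.  The size of the
    Green's function rests on [Lambda] being bounded on every half-plane
    [Re z >= - M] ([Lambda_bound]); on the positive reals this is where the value of the
    Gaussian integral enters. *)

(** * Complex differentiation with locally uniform quadratic remainder *)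

(** Every entire function satisfies this quadratic bound on discs. Taking it as the
    definition of a derivative makes the remainder uniform at once, so that
    differentiation under an integral needs no compactness argument, and it is
    stable under sums, products and compositions with explicit constants. *)
Definition holo (f f' : C -> C) : Prop :=
  forall M, exists L, 0 <= L /\ forall z w, Cmod z <= M -> Cmod w <= M ->
    Cmod (f w - f z - (w - z) * f' z) <= L * Cmod (w - z) ^ 2.

Lemma Cmod_minus_sym (z w : C) : Cmod (w - z) = Cmod (z - w).
Proof. rewrite <- Cmod_opp; f_equal; ring. Qed.

Lemma Cmod_minus_le (z w : C) : Cmod (z - w) <= Cmod z + Cmod w.
Proof. unfold Cminus; eapply Rle_trans; [apply Cmod_triangle|]. rewrite Cmod_opp; lra. Qed.

Lemma Cmod_sub_bound (z w : C) : Cmod w <= Cmod z + Cmod (w - z).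
Proof. replace w with (z + (w - z))%C at 1 by ring. apply Cmod_triangle. Qed.

Lemma Cmod_0_eq (z : C) : Cmod z <= 0 -> z = 0%C.
Proof.
  intros H; apply Cmod_eq_0; apply Rle_antisym; [exact H|apply Cmod_ge_0].
Qed.

(** Adding the expansions of [f] at [z] and at [w] leaves [(w - z) (f' w - f' z)],
    which both remainders bound quadratically. *)
Lemma holo_deriv_lipschitz (f f' : C -> C) : holo f f' ->
  forall M, exists L, 0 <= L /\ forall z w, Cmod z <= M -> Cmod w <= M ->
    Cmod (f' w - f' z) <= L * Cmod (w - z).
Proof.
  intros H M; destruct (H M) as [L [HL H1]].
  exists (2 * L); split; [lra|]; intros z w Hz Hw.
  destruct (Rle_lt_dec (Cmod (w - z)) 0) as [E|E].
  - apply Cmod_0_eq in E.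
    replace w with z by (rewrite <- (Cplus_0_r z), <- E; ring).
    replace (f' z - f' z)%C with (RtoC 0) by ring.
    rewrite Cmod_0; replace (z - z)%C with (RtoC 0) by ring; rewrite Cmod_0; lra.
  - apply Rmult_le_reg_l with (1 := E).
    rewrite <- Cmod_mult.
    replace ((w - z) * (f' w - f' z))%C with
      ((f w - f z - (w - z) * f' z) + (f z - f w - (z - w) * f' w))%C
      by ring.
    eapply Rle_trans; [apply Cmod_triangle|].
    generalize (H1 z w Hz Hw) (H1 w z Hw Hz); rewrite (Cmod_minus_sym w z).
    intros; nra.
Qed.

Lemma holo_deriv_bounded (f f' : C -> C) : holo f f' ->
  forall M, exists L, 0 <= L /\ forall z, Cmod z <= M -> Cmod (f' z) <= L.
Proof.
  intros H M; destruct (holo_deriv_lipschitz f f' H (Rmax 0 M)) as [L [HL H1]].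
  exists (Cmod (f' 0%C) + L * Rmax 0 M); split.
  { generalize (Cmod_ge_0 (f' 0%C)) (Rmax_l 0 M); intros; nra. }
  intros z Hz.
  eapply Rle_trans; [apply (Cmod_sub_bound (f' 0%C))|].
  apply Rplus_le_compat_l.
  assert (Hz' : Cmod z <= Rmax 0 M) by (eapply Rle_trans; [exact Hz|apply Rmax_r]).
  eapply Rle_trans; [apply H1|].
  - rewrite Cmod_0; apply Rmax_l.
  - exact Hz'.
  - apply Rmult_le_compat_l; [lra|].
    replace (z - 0)%C with z by ring; exact Hz'.
Qed.

Lemma holo_lipschitz (f f' : C -> C) : holo f f' ->
  forall M, exists L, 0 <= L /\ forall z w, Cmod z <= M -> Cmod w <= M ->
    Cmod (f w - f z) <= L * Cmod (w - z).
Proof.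
  intros H M; destruct (H M) as [L [HL H1]].
  destruct (holo_deriv_bounded _ _ H M) as [L' [HL' H2]].
  exists (L' + L * (2 * Rmax 0 M)); split.
  { generalize (Rmax_l 0 M); intros; nra. }
  intros z w Hz Hw.
  replace (f w - f z)%C with ((f w - f z - (w - z) * f' z) + (w - z) * f' z)%C by ring.
  eapply Rle_trans; [apply Cmod_triangle|].
  rewrite Cmod_mult.
  generalize (H1 z w Hz Hw) (H2 z Hz) (Cmod_minus_le w z) (Cmod_ge_0 (w - z)) (Rmax_r 0 M).
  intros.
  assert (Cmod (w - z) * Cmod (f' z) <= Cmod (w - z) * L') by (apply Rmult_le_compat_l; lra).
  assert (L * Cmod (w - z) ^ 2 <= L * (2 * Rmax 0 M) * Cmod (w - z)).
  { replace (L * Cmod (w - z) ^ 2) with (L * Cmod (w - z) * Cmod (w - z)) by ring.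
    rewrite !Rmult_assoc; apply Rmult_le_compat_l; [lra|]. nra. }
  lra.
Qed.

Lemma holo_bounded (f f' : C -> C) : holo f f' ->
  forall M, exists L, 0 <= L /\ forall z, Cmod z <= M -> Cmod (f z) <= L.
Proof.
  intros H M; destruct (holo_lipschitz f f' H (Rmax 0 M)) as [L [HL H1]].
  exists (Cmod (f 0%C) + L * Rmax 0 M); split.
  { generalize (Cmod_ge_0 (f 0%C)) (Rmax_l 0 M); intros; nra. }
  intros z Hz.
  eapply Rle_trans; [apply (Cmod_sub_bound (f 0%C))|].
  apply Rplus_le_compat_l.
  assert (Hz' : Cmod z <= Rmax 0 M) by (eapply Rle_trans; [exact Hz|apply Rmax_r]).
  eapply Rle_trans; [apply H1|].
  - rewrite Cmod_0; apply Rmax_l.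
  - exact Hz'.
  - apply Rmult_le_compat_l; [lra|].
    replace (z - 0)%C with z by ring; exact Hz'.
Qed.

Lemma holo_ext (f f' g g' : C -> C) : holo f f' ->
  (forall z, f z = g z) -> (forall z, f' z = g' z) -> holo g g'.
Proof.
  intros H E E' M; destruct (H M) as [L [HL H1]]; exists L; split; [exact HL|].
  intros z w; rewrite <- !E, <- E'; apply H1.
Qed.

Lemma holo_const (a : C) : holo (fun _ => a) (fun _ => 0%C).
Proof.
  intros M; exists 0; split; [lra|]; intros z w _ _.
  replace (a - a - (w - z) * 0)%C with (RtoC 0) by ring; rewrite Cmod_0; lra.
Qed.

Lemma holo_id : holo (fun z => z) (fun _ => 1%C).
Proof.
  intros M; exists 0; split; [lra|]; intros z w _ _.
  replace (w - z - (w - z) * 1)%C with (RtoC 0) by ring; rewrite Cmod_0; lra.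
Qed.

Lemma holo_plus (f f' g g' : C -> C) : holo f f' -> holo g g' ->
  holo (fun z => f z + g z)%C (fun z => f' z + g' z)%C.
Proof.
  intros Hf Hg M; destruct (Hf M) as [L [HL H1]]; destruct (Hg M) as [K [HK H2]].
  exists (L + K); split; [lra|]; intros z w Hz Hw.
  replace (f w + g w - (f z + g z) - (w - z) * (f' z + g' z))%C with
    ((f w - f z - (w - z) * f' z) + (g w - g z - (w - z) * g' z))%C by ring.
  eapply Rle_trans; [apply Cmod_triangle|].
  rewrite Rmult_plus_distr_r; apply Rplus_le_compat; auto.
Qed.

Lemma holo_mult (f f' g g' : C -> C) : holo f f' -> holo g g' ->
  holo (fun z => f z * g z)%C (fun z => f' z * g z + f z * g' z)%C.
Proof.
  intros Hf Hg M.
  destruct (Hf M) as [L [HL H1]]; destruct (Hg M) as [K [HK H2]].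
  destruct (holo_lipschitz _ _ Hf M) as [L1 [HL1 H3]].
  destruct (holo_lipschitz _ _ Hg M) as [K1 [HK1 H4]].
  destruct (holo_bounded _ _ Hf M) as [L0 [HL0 H5]].
  destruct (holo_bounded _ _ Hg M) as [K0 [HK0 H6]].
  exists (L * K0 + L0 * K + L1 * K1); split.
  { generalize (Rmult_le_pos _ _ HL HK0) (Rmult_le_pos _ _ HL0 HK) (Rmult_le_pos _ _ HL1 HK1); lra. }
  intros z w Hz Hw.
  replace (f w * g w - f z * g z - (w - z) * (f' z * g z + f z * g' z))%C with
    ((f w - f z - (w - z) * f' z) * g z + f z * (g w - g z - (w - z) * g' z)
     + (f w - f z) * (g w - g z))%C by ring.
  eapply Rle_trans; [apply Cmod_triangle|].
  rewrite Rmult_plus_distr_r; apply Rplus_le_compat.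
  - eapply Rle_trans; [apply Cmod_triangle|].
    rewrite !Cmod_mult, Rmult_plus_distr_r; apply Rplus_le_compat.
    + replace (L * K0 * Cmod (w - z) ^ 2) with (L * Cmod (w - z) ^ 2 * K0) by ring.
      apply Rmult_le_compat; auto using Cmod_ge_0.
    + rewrite Rmult_assoc; apply Rmult_le_compat; auto using Cmod_ge_0.
  - rewrite Cmod_mult.
    replace (L1 * K1 * Cmod (w - z) ^ 2)
      with ((L1 * Cmod (w - z)) * (K1 * Cmod (w - z))) by ring.
    apply Rmult_le_compat; auto using Cmod_ge_0.
Qed.

(** Both points [g z] and [g w] lie in one disc, so the expansion of [f] there can
    be used whatever their distance; this is why [holo] does not ask that [w] be
    close to [z]. *)
Lemma holo_comp (f f' g g' : C -> C) : holo f f' -> holo g g' ->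
  holo (fun z => f (g z)) (fun z => g' z * f' (g z))%C.
Proof.
  intros Hf Hg M.
  destruct (holo_bounded _ _ Hg M) as [N [HN H0]].
  destruct (Hf N) as [L [HL H1]]; destruct (Hg M) as [K [HK H2]].
  destruct (holo_deriv_bounded _ _ Hf N) as [L1 [HL1 H3]].
  destruct (holo_lipschitz _ _ Hg M) as [K1 [HK1 H4]].
  (* [|g w - g z| <= K1 |w - z|] enters squared through the remainder of [f]; the
     remainder of [g] is multiplied by [|f'| <= L1]. *)
  exists (L * K1 ^ 2 + K * L1); split.
  { generalize (Rmult_le_pos _ _ HL (pow2_ge_0 K1)) (Rmult_le_pos _ _ HK HL1); lra. }
  intros z w Hz Hw.
  replace (f (g w) - f (g z) - (w - z) * (g' z * f' (g z)))%C with
    ((f (g w) - f (g z) - (g w - g z) * f' (g z))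
     + (g w - g z - (w - z) * g' z) * f' (g z))%C by ring.
  eapply Rle_trans; [apply Cmod_triangle|].
  rewrite Rmult_plus_distr_r; apply Rplus_le_compat.
  - eapply Rle_trans; [apply H1; auto|].
    rewrite Rmult_assoc, <- Rpow_mult_distr.
    apply Rmult_le_compat_l; [exact HL|].
    apply pow_incr; split; [apply Cmod_ge_0|auto].
  - rewrite Cmod_mult.
    replace (K * L1 * Cmod (w - z) ^ 2) with (K * Cmod (w - z) ^ 2 * L1) by ring.
    apply Rmult_le_compat; auto using Cmod_ge_0.
Qed.

Lemma norm_Cmod (z : C) : @norm R_AbsRing C_R_NormedModule z = Cmod z.
Proof.
  unfold norm, Cmod; simpl. unfold prod_norm; f_equal.
  unfold norm; simpl; unfold abs; simpl.
  rewrite !Rmult_1_r, <- !Rabs_mult.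
  rewrite !Rabs_pos_eq; [reflexivity|apply Rle_0_sqr..].
Qed.

Lemma Cmod_RInt_le (f : R -> C) (g : R -> R) (a b : R) (l : C) (m : R) :
  a <= b -> (forall s, a <= s <= b -> Cmod (f s) <= g s) ->
  @is_RInt C_R_NormedModule f a b l -> is_RInt g a b m -> Cmod l <= m.
Proof.
  intros Hab H Hf Hg. rewrite <- norm_Cmod.
  refine (@norm_RInt_le C_R_NormedModule f g a b l m Hab _ Hf Hg).
  intros x Hx; rewrite norm_Cmod; auto.
Qed.

Lemma Cmod_RInt_le_const (f : R -> C) (a b m : R) (l : C) :
  a <= b -> (forall s, a <= s <= b -> Cmod (f s) <= m) ->
  @is_RInt C_R_NormedModule f a b l -> Cmod l <= (b - a) * m.
Proof.
  intros Hab H Hf; apply (Cmod_RInt_le f (fun _ => m) a b l _ Hab H Hf).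
  apply (@is_RInt_const R_NormedModule).
Qed.

Lemma continuous_C_R (f : R -> C) (x L : R) :
  (forall u, Rabs (u - x) <= 1 -> Cmod (f u - f x) <= L * Rabs (u - x)) ->
  @continuous R_UniformSpace C_R_NormedModule f x.
Proof.
  intros H. 
  apply (proj2 (@filterlim_locally_ball_norm _ R_AbsRing C_R_NormedModule _ _ f (f x))).
  intros eps.
  assert (Hd : 0 < Rmin 1 (eps / (Rabs L + 1))).
  { apply Rmin_case; [lra|]. apply Rdiv_lt_0_compat; [apply cond_pos|].
    generalize (Rabs_pos L); lra. }
  exists (mkposreal _ Hd); intros y Hy.
  change (Rabs (y - x) < Rmin 1 (eps / (Rabs L + 1))) in Hy.
  unfold ball_norm; rewrite norm_Cmod.
  change (minus (f y) (f x)) with (f y - f x)%C.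
  eapply Rle_lt_trans; [apply H|].
  { left; eapply Rlt_le_trans; [exact Hy|apply Rmin_l]. }
  assert (Hy2 : Rabs (y - x) < eps / (Rabs L + 1))
    by (eapply Rlt_le_trans; [exact Hy|apply Rmin_r]).
  apply Rlt_div_r in Hy2; [|generalize (Rabs_pos L); lra].
  generalize (Rle_abs L) (Rabs_pos (y - x)) (Rabs_pos L); intros; nra.
Qed.

Lemma holo_continuous_real (f f' : C -> C) (x : R) : holo f f' ->
  @continuous R_UniformSpace C_R_NormedModule (fun s => f (RtoC s)) x.
Proof.
  intros H; destruct (holo_lipschitz _ _ H (Rabs x + 1)) as [L [HL H1]].
  apply continuous_C_R with L; intros u Hu.
  rewrite <- Cmod_R, RtoC_minus; apply H1; rewrite Cmod_R; [lra|].
  replace u with (x + (u - x)) by ring.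
  eapply Rle_trans; [apply Rabs_triang|lra].
Qed.

Lemma ex_RInt_holo (f f' : C -> C) (a b : R) : holo f f' ->
  @ex_RInt C_R_NormedModule (fun s => f (RtoC s)) a b.
Proof.
  intros H; apply (@ex_RInt_continuous C_R_CompleteNormedModule); intros z _.
  eapply holo_continuous_real; exact H.
Qed.

Lemma holo_FTC (f f' : C -> C) (a b : R) : holo f f' ->
  @is_RInt C_R_NormedModule (fun s => f' (RtoC s)) a b (f (RtoC b) - f (RtoC a))%C.
Proof.
  intros H.
  apply (@is_RInt_derive C_R_CompleteNormedModule (fun s => f (RtoC s)) (fun s => f' (RtoC s))).
  - intros x _. split; [apply is_linear_scal_l|].
    intros y Hy; apply (is_filter_lim_locally_unique x y) in Hy; subst y.
    intros eps; destruct (H (Rabs x + 1)) as [L [HL H1]].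
    assert (Hd : 0 < Rmin 1 (eps / (L + 1))).
    { apply Rmin_case; [lra|]. apply Rdiv_lt_0_compat; [apply cond_pos|lra]. }
    exists (mkposreal _ Hd); intros y Hy.
    change (Rabs (y - x) < Rmin 1 (eps / (L + 1))) in Hy.
    change (@norm R_AbsRing C_R_NormedModule
      (@minus C_R_NormedModule (f (RtoC y) - f (RtoC x))%C
         (@scal R_AbsRing C_R_NormedModule (y - x) (f' (RtoC x))))
      <= eps * Rabs (y - x)).
    rewrite norm_Cmod, scal_R_Cmult.
    change (Cmod (f (RtoC y) - f (RtoC x) - (RtoC (y - x)) * f' (RtoC x)) <= eps * Rabs (y - x)).
    assert (Hy1 : Rabs (y - x) < 1) by (eapply Rlt_le_trans; [exact Hy|apply Rmin_l]).
    assert (Hy2 : Rabs (y - x) < eps / (L + 1))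
      by (eapply Rlt_le_trans; [exact Hy|apply Rmin_r]).
    apply Rlt_div_r in Hy2; [|lra].
    rewrite RtoC_minus.
    eapply Rle_trans; [apply H1; rewrite Cmod_R|].
    + lra.
    + replace y with (x + (y - x)) by ring.
      eapply Rle_trans; [apply Rabs_triang|lra].
    + rewrite <- RtoC_minus, Cmod_R.
      generalize (Rabs_pos (y - x)); intros; nra.
  - intros x _.
    destruct (holo_deriv_lipschitz _ _ H (Rabs x + 1)) as [L [HL H1]].
    apply continuous_C_R with L; intros u Hu.
    rewrite <- Cmod_R, RtoC_minus; apply H1; rewrite Cmod_R; [lra|].
    replace u with (x + (u - x)) by ring.
    eapply Rle_trans; [apply Rabs_triang|lra].
Qed.

Lemma holo_affine (a v : C) : holo (fun z => a + z * v)%C (fun _ => v).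
Proof.
  eapply holo_ext.
  - apply (holo_plus _ _ _ _ (holo_const a) (holo_mult _ _ _ _ holo_id (holo_const v))).
  - intros; reflexivity.
  - intros; simpl; ring.
Qed.

Lemma holo_FTC_line (f f' : C -> C) (p v : C) (a b : R) : holo f f' ->
  @is_RInt C_R_NormedModule (fun s => v * f' (p + RtoC s * v))%C a b
    (f (p + RtoC b * v) - f (p + RtoC a * v))%C.
Proof.
  intros H; apply (holo_FTC _ _ a b (holo_comp _ _ _ _ H (holo_affine p v))).
Qed.

(** The case [f w = exp (- w^2)] is, up to the factor [2 / sqrt PI], the very
    integral that defines [Cerf]. *)
Definition segment_primitive (f : C -> C) (z : C) : C :=
  RInt (V := C_R_CompleteNormedModule) (fun s : R => (f (RtoC s * z) * z)%C) 0 1.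

Lemma is_RInt_segment_primitive (f f' : C -> C) (z : C) : holo f f' ->
  @is_RInt C_R_NormedModule (fun s : R => (f (RtoC s * z) * z)%C) 0 1 (segment_primitive f z).
Proof.
  intros H. apply (@RInt_correct C_R_CompleteNormedModule).
  destruct (ex_RInt_holo _ _ 0 1
    (holo_mult _ _ _ _ (holo_comp _ _ _ _ H (holo_affine 0 z)) (holo_const z))) as [l Hl].
  exists l; eapply is_RInt_ext; [|exact Hl].
  intros x _; simpl; now rewrite Cplus_0_l.
Qed.

(** Differentiate [f (s z) z] in [z]: the result is [f (s z) + s z f' (s z)], the
    derivative of [s f (s z)] in [s], whose integral over [0, 1] is [f z]. The
    quadratic remainder of the integrand is uniform in [s]. *)
Lemma holo_segment_primitive (f f' : C -> C) : holo f f' -> holo (segment_primitive f) f.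
Proof.
  intros H M0; set (M := Rmax 0 M0).
  assert (HM : 0 <= M) by apply Rmax_l.
  destruct (H M) as [L [HL H1]].
  destruct (holo_deriv_bounded _ _ H M) as [L' [HL' H2]].
  exists (L * M + L'); split; [generalize (Rmult_le_pos _ _ HL HM); lra|].
  intros z w Hz Hw.
  assert (Hz' : Cmod z <= M) by (eapply Rle_trans; [exact Hz|apply Rmax_r]).
  assert (Hw' : Cmod w <= M) by (eapply Rle_trans; [exact Hw|apply Rmax_r]).
  (* [(w - z) f z] is written as an integral over the same interval, so that the
     whole remainder becomes a single integral. *)
  assert (I3 : @is_RInt C_R_NormedModule
    (fun s => (w - z) * (f (RtoC s * z) + RtoC s * (z * f' (RtoC s * z))))%C 0 1
    ((w - z) * f z)%C).
  { generalize (holo_FTC _ _ 0 1 (holo_mult _ _ _ _ (holo_const (w - z)%C)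
      (holo_mult _ _ _ _ holo_id (holo_comp _ _ _ _ H (holo_affine 0 z))))).
    simpl. intros HI.
    replace ((w - z) * f z)%C with ((w - z) * (1 * f (0 + 1 * z)) - (w - z) * (0 * f (0 + 0 * z)))%C.
    2:{ replace (0 + 1 * z)%C with z by ring; ring. }
    eapply is_RInt_ext; [|exact HI].
    intros x _; simpl. rewrite Cplus_0_l; ring. }
  assert (I : @is_RInt C_R_NormedModule
    (fun s => f (RtoC s * w) * w - f (RtoC s * z) * z
       - (w - z) * (f (RtoC s * z) + RtoC s * (z * f' (RtoC s * z))))%C 0 1
    (segment_primitive f w - segment_primitive f z - (w - z) * f z)%C).
  { apply (@is_RInt_minus C_R_NormedModule
      (fun s => f (RtoC s * w) * w - f (RtoC s * z) * z)%C); [|exact I3].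
    apply (@is_RInt_minus C_R_NormedModule
      (fun s => f (RtoC s * w) * w)%C (fun s => f (RtoC s * z) * z)%C);
      eapply is_RInt_segment_primitive; exact H. }
  replace ((L * M + L') * Cmod (w - z) ^ 2)
    with ((1 - 0) * ((L * M + L') * Cmod (w - z) ^ 2)) by ring.
  refine (Cmod_RInt_le_const _ 0 1 _ _ _ _ I); [lra|].
  intros s Hs; cbv beta.
  replace (f (RtoC s * w) * w - f (RtoC s * z) * z
       - (w - z) * (f (RtoC s * z) + RtoC s * (z * f' (RtoC s * z))))%C with
    ((f (RtoC s * w) - f (RtoC s * z) - (RtoC s * w - RtoC s * z) * f' (RtoC s * z)) * w
     + RtoC s * ((w - z) ^ 2 * f' (RtoC s * z)))%C.
  2:{ simpl; ring. }
  assert (Hsm : forall u, Cmod u <= M -> Cmod (RtoC s * u) <= M).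
  { intros u Hu; rewrite Cmod_mult, Cmod_R, Rabs_pos_eq by lra.
    generalize (Cmod_ge_0 u); intros; nra. }
  eapply Rle_trans; [apply Cmod_triangle|].
  rewrite Rmult_plus_distr_r; apply Rplus_le_compat.
  - rewrite Cmod_mult. replace (L * M * Cmod (w - z) ^ 2) with (L * Cmod (w - z) ^ 2 * M) by ring.
    apply Rmult_le_compat; auto using Cmod_ge_0.
    eapply Rle_trans; [apply H1; auto|].
    apply Rmult_le_compat_l; [exact HL|].
    replace (RtoC s * w - RtoC s * z)%C with (RtoC s * (w - z))%C by ring.
    rewrite Cmod_mult, Cmod_R, Rabs_pos_eq by lra.
    apply pow_incr; generalize (Cmod_ge_0 (w - z)); intros; nra.
  - rewrite !Cmod_mult, Cmod_R, (Rabs_pos_eq s), Cmod_pow by lra.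
    generalize (H2 _ (Hsm _ Hz')) (Cmod_ge_0 (f' (RtoC s * z)%C)) (pow2_ge_0 (Cmod (w - z))); intros.
    replace (L' * Cmod (w - z) ^ 2) with (1 * (Cmod (w - z) ^ 2 * L')) by ring.
    apply Rmult_le_compat; try lra; [nra|].
    apply Rmult_le_compat_l; lra.
Qed.

Lemma segment_primitive_0 (f : C -> C) : segment_primitive f 0 = 0%C.
Proof.
  generalize (@is_RInt_const C_R_NormedModule 0 1 (RtoC 0)).
  rewrite scal_R_Cmult, Cmult_0_r; intros H.
  refine (is_RInt_unique (V := C_R_CompleteNormedModule)
    (fun s => f (RtoC s * 0) * 0)%C 0 1 (RtoC 0) _).
  eapply is_RInt_ext; [|exact H]; intros s _; symmetry; apply Cmult_0_r.
Qed.


(** * The exponential, the error function and Lambda *)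

Lemma exp_le (x y : R) : x <= y -> exp x <= exp y.
Proof. intros [H| ->]; [left; apply exp_increasing, H|right; reflexivity]. Qed.

Lemma Cexp_plus (z w : C) : Cexp (z + w) = (Cexp z * Cexp w)%C.
Proof.
  destruct z as [a b], w as [c d]; unfold Cexp, Cmult, Cplus; simpl.
  rewrite exp_plus, cos_plus, sin_plus; f_equal; ring.
Qed.

Lemma Cmod_Cexp (z : C) : Cmod (Cexp z) = exp (Re z).
Proof.
  unfold Cmod, Cexp; simpl.
  replace (exp (Re z) * cos (Im z) * (exp (Re z) * cos (Im z) * 1) +
     exp (Re z) * sin (Im z) * (exp (Re z) * sin (Im z) * 1))
   with (exp (Re z) ^ 2 * (Rsqr (sin (Im z)) + Rsqr (cos (Im z)))) by (unfold Rsqr; ring).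
  rewrite sin2_cos2, Rmult_1_r, sqrt_pow2; [reflexivity|left; apply exp_pos].
Qed.

Lemma Re_le_Cmod (z : C) : Re z <= Cmod z.
Proof. eapply Rle_trans; [apply Rle_abs|apply re_le_Cmod]. Qed.

Lemma is_RInt_Cexp (z : C) (b : R) :
  @is_RInt C_R_NormedModule (fun s => z * Cexp (RtoC s * z))%C 0 b (Cexp (RtoC b * z) - 1)%C.
Proof.
  destruct z as [x y].
  replace (Cexp (RtoC b * (x, y)) - 1)%C with
    (exp (b * x) * cos (b * y) - exp (0 * x) * cos (0 * y),
     exp (b * x) * sin (b * y) - exp (0 * x) * sin (0 * y)).
  2:{ rewrite !Rmult_0_l, exp_0, cos_0, sin_0.
      unfold Cexp, Cminus, Cplus, Cmult, Copp, RtoC; simpl.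
      rewrite !Rmult_0_l, Rminus_0_r, Rplus_0_r. f_equal; ring. }
  apply (@is_RInt_fct_extend_pair R_NormedModule R_NormedModule).
  - apply is_RInt_ext with
      (fun s => x * exp (s * x) * cos (s * y) + exp (s * x) * (- y * sin (s * y))).
    { intros s _; simpl. rewrite !Rmult_0_l, Rminus_0_r, Rplus_0_r. ring. }
    apply (@is_RInt_derive R_CompleteNormedModule (fun s => exp (s * x) * cos (s * y))).
    + intros s _; auto_derive; [trivial|ring].
    + intros s _; apply (@ex_derive_continuous R_AbsRing R_NormedModule); auto_derive; trivial.
  - apply is_RInt_ext with
      (fun s => x * exp (s * x) * sin (s * y) + exp (s * x) * (y * cos (s * y))).
    { intros s _; simpl. rewrite !Rmult_0_l, Rminus_0_r, Rplus_0_r. ring. }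
    apply (@is_RInt_derive R_CompleteNormedModule (fun s => exp (s * x) * sin (s * y))).
    + intros s _; auto_derive; [trivial|ring].
    + intros s _; apply (@ex_derive_continuous R_AbsRing R_NormedModule); auto_derive; trivial.
Qed.

Lemma Cmod_Cexp_scale_le (z : C) (s b : R) : 0 <= s <= b ->
  Cmod (Cexp (RtoC s * z)) <= exp (b * Cmod z).
Proof.
  intros H; rewrite Cmod_Cexp.
  apply exp_le. eapply Rle_trans; [apply Re_le_Cmod|].
  rewrite Cmod_mult, Cmod_R, Rabs_pos_eq by lra.
  apply Rmult_le_compat_r; [apply Cmod_ge_0|lra].
Qed.

Lemma Cexp_minus_1_le (z : C) (b : R) : 0 <= b <= 1 ->
  Cmod (Cexp (RtoC b * z) - 1) <= Cmod z * exp (Cmod z).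
Proof.
  intros Hb.
  eapply Rle_trans;
    [apply (Cmod_RInt_le_const (fun s => z * Cexp (RtoC s * z))%C 0 b (Cmod z * exp (Cmod z)));
       [lra| |apply is_RInt_Cexp]|].
  - intros s Hs; rewrite Cmod_mult.
    apply Rmult_le_compat_l; [apply Cmod_ge_0|].
    rewrite <- (Rmult_1_l (Cmod z)); apply Cmod_Cexp_scale_le; lra.
  - generalize (Rmult_le_pos _ _ (Cmod_ge_0 z) (Rlt_le _ _ (exp_pos (Cmod z)))).
    intros; nra.
Qed.

(** Integrate [z (exp (s z) - 1)] over [0 <= s <= 1], using the first-order bound
    [Cexp_minus_1_le] for the bracket. *)
Lemma Cexp_remainder_le (z : C) :
  Cmod (Cexp z - 1 - z) <= Cmod z ^ 2 * exp (Cmod z).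
Proof.
  replace (Cmod z ^ 2 * exp (Cmod z)) with ((1 - 0) * (Cmod z ^ 2 * exp (Cmod z))) by ring.
  apply (Cmod_RInt_le_const (fun s => z * Cexp (RtoC s * z) - z)%C 0 1).
  - lra.
  - intros s Hs; replace (z * Cexp (RtoC s * z) - z)%C
      with (z * (Cexp (RtoC s * z) - 1))%C by ring.
    rewrite Cmod_mult. simpl; rewrite Rmult_1_r, Rmult_assoc.
    apply Rmult_le_compat_l; [apply Cmod_ge_0|].
    apply Cexp_minus_1_le; exact Hs.
  - generalize (is_RInt_Cexp z 1); rewrite Cmult_1_l; intros H.
    apply (@is_RInt_minus C_R_NormedModule (fun s => z * Cexp (RtoC s * z))%C (fun _ => z) _ _ _ _ H).
    generalize (@is_RInt_const C_R_NormedModule 0 1 z).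
    rewrite scal_R_Cmult, Rminus_0_r, Cmult_1_l. trivial.
Qed.

Lemma holo_Cexp : holo Cexp Cexp.
Proof.
  intros M; set (N := Rmax 0 M).
  exists (exp N * exp (2 * N)); split.
  { generalize (exp_pos N) (exp_pos (2 * N)); intros; nra. }
  intros z w Hz Hw.
  assert (HN := Rmax_r 0 M); fold N in HN.
  replace (Cexp w - Cexp z - (w - z) * Cexp z)%C with
    (Cexp z * (Cexp (w - z) - 1 - (w - z)))%C.
  2:{ replace (Cexp w) with (Cexp (z + (w - z))) by (f_equal; ring).
      rewrite Cexp_plus; ring. }
  rewrite Cmod_mult, Rmult_assoc.
  apply Rmult_le_compat; try apply Cmod_ge_0.
  - rewrite Cmod_Cexp; apply exp_le; generalize (Re_le_Cmod z); lra.
  - eapply Rle_trans; [apply Cexp_remainder_le|].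
    rewrite Rmult_comm; apply Rmult_le_compat_r; [apply pow2_ge_0|].
    apply exp_le; generalize (Cmod_minus_le w z); lra.
Qed.

Definition entire (f : C -> C) : Prop := exists f', holo f f'.

Lemma entire_const (a : C) : entire (fun _ => a).
Proof. eexists; apply holo_const. Qed.
Lemma entire_id : entire (fun z => z).
Proof. eexists; apply holo_id. Qed.
Lemma entire_plus (f g : C -> C) : entire f -> entire g -> entire (fun z => f z + g z)%C.
Proof. intros [f' Hf] [g' Hg]; eexists; apply (holo_plus _ _ _ _ Hf Hg). Qed.
Lemma entire_mult (f g : C -> C) : entire f -> entire g -> entire (fun z => f z * g z)%C.
Proof. intros [f' Hf] [g' Hg]; eexists; apply (holo_mult _ _ _ _ Hf Hg). Qed.
Lemma entire_comp (f g : C -> C) : entire f -> entire g -> entire (fun z => f (g z))%C.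
Proof. intros [f' Hf] [g' Hg]; eexists; apply (holo_comp _ _ _ _ Hf Hg). Qed.
Lemma entire_ext (f g : C -> C) : (forall z, f z = g z) -> entire f -> entire g.
Proof. intros E [f' Hf]; exists f'; eapply holo_ext; eauto. Qed.
Lemma entire_opp (f : C -> C) : entire f -> entire (fun z => - f z)%C.
Proof.
  intros H; apply (entire_ext (fun z => (-1) * f z)%C); [intros; ring|].
  apply entire_mult; [apply entire_const|exact H].
Qed.
Lemma entire_minus (f g : C -> C) : entire f -> entire g -> entire (fun z => f z - g z)%C.
Proof. intros Hf Hg; apply entire_plus; [exact Hf|apply entire_opp, Hg]. Qed.
Lemma entire_pow (f : C -> C) (n : nat) : entire f -> entire (fun z => f z ^ n)%C.
Proof.
  intros Hf; induction n as [|n IH]; [apply (entire_const 1)|].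
  apply (entire_mult f _ Hf IH).
Qed.
Lemma entire_div (f : C -> C) (a : C) : entire f -> entire (fun z => f z / a)%C.
Proof. intros Hf; apply entire_mult; [exact Hf|apply entire_const]. Qed.
Lemma entire_Cexp (f : C -> C) : entire f -> entire (fun z => Cexp (f z)).
Proof. apply entire_comp; eexists; apply holo_Cexp. Qed.

Lemma entire_gaussian : entire (fun z => Cexp (- z ^ 2)).
Proof. apply entire_Cexp, entire_opp, entire_pow, entire_id. Qed.

Definition gauss_prim (z : C) : C := segment_primitive (fun w => Cexp (- w ^ 2)) z.

Lemma holo_gauss_prim : holo gauss_prim (fun z => Cexp (- z ^ 2)).
Proof. destruct entire_gaussian as [f' H]; apply (holo_segment_primitive _ _ H). Qed.

Lemma Cerf_gauss_prim (z : C) : Cerf z = (RtoC (2 / sqrt PI) * gauss_prim z)%C.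
Proof. reflexivity. Qed.

Lemma entire_Lambda : entire Lambda.
Proof.
  apply entire_mult; [apply entire_Cexp, entire_pow, entire_id|].
  apply entire_minus; [apply entire_const|].
  apply (entire_mult (fun _ => RtoC (2 / sqrt PI)) gauss_prim); [apply entire_const|].
  eexists; apply holo_gauss_prim.
Qed.

Definition gauss_int (x : R) : R := RInt (fun u => exp (- u ^ 2)) 0 x.

Lemma continuous_gauss x : continuous (fun u => exp (- u ^ 2)) x.
Proof. apply (@ex_derive_continuous R_AbsRing R_NormedModule); auto_derive; trivial. Qed.

Lemma ex_RInt_gauss a b : ex_RInt (fun u => exp (- u ^ 2)) a b.
Proof. apply (@ex_RInt_continuous R_CompleteNormedModule); intros; apply continuous_gauss. Qed.

Lemma is_derive_gauss_int x : is_derive gauss_int x (exp (- x ^ 2)).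
Proof.
  apply (@is_derive_RInt R_NormedModule (fun u => exp (- u ^ 2)) gauss_int 0 x).
  - exists (mkposreal 1 Rlt_0_1); intros y _. apply (@RInt_correct R_CompleteNormedModule), ex_RInt_gauss.
  - apply continuous_gauss.
Qed.

(** The auxiliary integral of the classical evaluation of the Gaussian integral: its
    derivative cancels that of [gauss_int x ^ 2]. *)
Definition gauss_companion (x : R) : R := RInt (fun t => exp (- (x ^ 2 * (1 + t ^ 2))) / (1 + t ^ 2)) 0 1.

Lemma one_plus_sqr_pos t : 0 < 1 + t ^ 2.
Proof. generalize (pow2_ge_0 t); lra. Qed.

Lemma is_derive_gauss_companion_fun x t :
  is_derive (fun x => exp (- (x ^ 2 * (1 + t ^ 2))) / (1 + t ^ 2)) x
    (- 2 * x * exp (- (x ^ 2 * (1 + t ^ 2)))).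
Proof.
  generalize (one_plus_sqr_pos t); intros.
  auto_derive; [lra|simpl; field; simpl in *; lra].
Qed.

Lemma is_RInt_gauss_companion x :
  is_RInt (fun t => exp (- (x ^ 2 * (1 + t ^ 2))) / (1 + t ^ 2)) 0 1 (gauss_companion x).
Proof.
  apply (@RInt_correct R_CompleteNormedModule), (@ex_RInt_continuous R_CompleteNormedModule).
  intros t _; apply (@ex_derive_continuous R_AbsRing R_NormedModule); auto_derive.
  generalize (one_plus_sqr_pos t); simpl; intros; lra.
Qed.

(** Differentiation under the integral removes the denominator; the substitution [u
    = x t] then gives back [gauss_int]. *)
Lemma is_derive_gauss_companion x : is_derive gauss_companion x (- 2 * exp (- x ^ 2) * gauss_int x).
Proof.
  assert (E : forall x t, Derive (fun x => exp (- (x ^ 2 * (1 + t ^ 2))) / (1 + t ^ 2)) x =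
     - 2 * x * exp (- (x ^ 2 * (1 + t ^ 2)))).
  { intros; apply is_derive_unique, is_derive_gauss_companion_fun. }
  replace (- 2 * exp (- x ^ 2) * gauss_int x) with
    (RInt (fun t => Derive (fun x => exp (- (x ^ 2 * (1 + t ^ 2))) / (1 + t ^ 2)) x) 0 1).
  - apply (is_derive_RInt_param (fun x t => exp (- (x ^ 2 * (1 + t ^ 2))) / (1 + t ^ 2)) 0 1 x).
    + exists (mkposreal 1 Rlt_0_1); intros y _ t _; eexists; apply is_derive_gauss_companion_fun.
    + intros t _. 
      apply continuity_2d_pt_ext with (fun u v => - 2 * u * exp (- (u ^ 2 * (1 + v ^ 2)))).
      { intros; symmetry; apply E. }
      apply continuity_2d_pt_mult.
      * apply continuity_2d_pt_mult; [apply continuity_2d_pt_const|apply continuity_2d_pt_id1].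
      * apply (continuity_1d_2d_pt_comp exp (fun u v => - (u ^ 2 * (1 + v ^ 2)))).
        { apply derivable_continuous_pt, derivable_pt_exp. }
        simpl.
        repeat first [apply continuity_2d_pt_opp|apply continuity_2d_pt_mult|
          apply continuity_2d_pt_plus|apply continuity_2d_pt_const|apply continuity_2d_pt_id1|
          apply continuity_2d_pt_id2].
    + exists (mkposreal 1 Rlt_0_1); intros y _; eexists; apply is_RInt_gauss_companion.
  - apply is_RInt_unique.
    assert (I : is_RInt (fun u => exp (- u ^ 2)) (x * 0 + 0) (x * 1 + 0) (gauss_int x)).
    { rewrite Rmult_0_r, Rmult_1_r, !Rplus_0_r.
      apply (@RInt_correct R_CompleteNormedModule), ex_RInt_gauss. }
    apply (@is_RInt_comp_lin R_NormedModule) in I.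
    apply (@is_RInt_scal R_NormedModule _ _ _ (-2 * exp (- x ^ 2))) in I.
    eapply is_RInt_ext; [|exact I].
    intros t _; rewrite E; unfold scal; simpl; unfold mult; simpl.
    replace (- (x * (x * 1) * (1 + t * (t * 1)))) with
      (- (x * (x * 1)) + - ((x * t + 0) * ((x * t + 0) * 1))) by ring.
    rewrite exp_plus; ring.
Qed.

Lemma gauss_companion_0 : gauss_companion 0 = PI / 4.
Proof.
  rewrite <- atan_1. replace (atan 1) with (minus (atan 1) (atan 0)).
  2:{ rewrite atan_0; unfold minus, plus, opp; simpl; ring. }
  unfold gauss_companion; apply is_RInt_unique.
  apply is_RInt_ext with (fun t => / (1 + t ^ 2)).
  { intros t _; simpl. rewrite !Rmult_0_l, Ropp_0, exp_0; unfold Rdiv; ring. }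
  apply (@is_RInt_derive R_CompleteNormedModule atan).
  - intros t _; auto_derive; [trivial|].
    generalize (one_plus_sqr_pos t); unfold Rsqr; simpl; intros; field; lra.
  - intros t _; apply (@ex_derive_continuous R_AbsRing R_NormedModule); auto_derive.
    generalize (one_plus_sqr_pos t); simpl; intros; lra.
Qed.

Lemma gauss_int_sqr (x : R) : gauss_int x ^ 2 + gauss_companion x = PI / 4.
Proof.
  rewrite <- gauss_companion_0.
  assert (H := fun y => is_derive_plus (fun y => gauss_int y ^ 2) gauss_companion y _ _
    (is_derive_pow gauss_int 2 y _ (is_derive_gauss_int y)) (is_derive_gauss_companion y)).
  assert (K : forall y, is_derive (fun y => gauss_int y ^ 2 + gauss_companion y) y 0).
  { intros y; generalize (H y); unfold plus; simpl.
    replace ((1 + 1) * exp (- (y * (y * 1))) * (gauss_int y * 1) + -2 * exp (- (y * (y * 1))) * gauss_int y)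
      with 0 by ring. trivial. }
  assert (E : gauss_int 0 = 0) by (unfold gauss_int; apply (@RInt_point R_CompleteNormedModule)).
  replace (gauss_companion 0) with (gauss_int 0 ^ 2 + gauss_companion 0) by (rewrite E; ring).
  destruct (MVT_gen (fun y => gauss_int y ^ 2 + gauss_companion y) 0 x (fun _ => 0)) as [c [_ Hc]].
  - intros y _; apply K.
  - intros y _; apply continuity_pt_filterlim.
    apply (@ex_derive_continuous R_AbsRing R_NormedModule (fun y => gauss_int y ^ 2 + gauss_companion y)).
    eexists; apply K.
  - lra.
Qed.

Lemma gauss_int_pos x : 0 <= x -> 0 <= gauss_int x.
Proof.
  intros H; unfold gauss_int; apply RInt_ge_0; [exact H|apply ex_RInt_gauss|].
  intros; left; apply exp_pos.
Qed.

Lemma gauss_companion_le x : 0 <= gauss_companion x <= exp (- x ^ 2).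
Proof.
  split.
  - apply (is_RInt_ge_0 (fun t => exp (- (x ^ 2 * (1 + t ^ 2))) / (1 + t ^ 2)) 0 1);
      [lra|apply is_RInt_gauss_companion|].
    intros t _; left; apply Rdiv_lt_0_compat; [apply exp_pos|apply one_plus_sqr_pos].
  - replace (exp (- x ^ 2)) with ((1 - 0) * exp (- x ^ 2)) by ring.
    apply (is_RInt_le (fun t => exp (- (x ^ 2 * (1 + t ^ 2))) / (1 + t ^ 2)) (fun _ => exp (- x ^ 2)) 0 1);
      [lra|apply is_RInt_gauss_companion|apply (@is_RInt_const R_NormedModule)|].
    intros t _. generalize (one_plus_sqr_pos t) (pow2_ge_0 t) (pow2_ge_0 x); intros.
    apply Rle_div_l; [lra|].
    assert (exp (- (x ^ 2 * (1 + t ^ 2))) <= exp (- x ^ 2)) by (apply exp_le; nra).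
    generalize (exp_pos (- x ^ 2)); intros; nra.
Qed.

(** By [gauss_int_sqr], [PI / 4 - gauss_int x ^ 2] is [gauss_companion x], which is
    at most [exp (- x^2)]; it factors as a difference of squares whose second factor
    is at least [sqrt PI / 2]. *)
Lemma erfc_bound_pos x : 0 <= x -> 0 <= sqrt PI / 2 - gauss_int x <= 2 / sqrt PI * exp (- x ^ 2).
Proof.
  intros Hx. assert (Hs : 0 < sqrt PI) by (apply sqrt_lt_R0, PI_RGT_0).
  assert (Hs2 : sqrt PI * sqrt PI = PI) by (apply sqrt_sqrt, Rlt_le, PI_RGT_0).
  generalize (gauss_int_sqr x) (gauss_companion_le x) (gauss_int_pos x Hx); intros E [H1 H2] HG.
  assert (E2 : (sqrt PI / 2 - gauss_int x) * (sqrt PI / 2 + gauss_int x) = gauss_companion x).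
  { transitivity (sqrt PI * sqrt PI / 4 - gauss_int x ^ 2); [field|rewrite Hs2; lra]. }
  assert (H3 : 0 <= sqrt PI / 2 - gauss_int x).
  { apply Rmult_le_reg_r with (sqrt PI / 2 + gauss_int x); [lra|]. rewrite E2; lra. }
  split; [exact H3|].
  apply Rmult_le_reg_r with (sqrt PI / 2); [lra|].
  replace (2 / sqrt PI * exp (- x ^ 2) * (sqrt PI / 2)) with (exp (- x ^ 2)) by (field; lra).
  eapply Rle_trans; [|exact H2]. rewrite <- E2. apply Rmult_le_compat_l; lra.
Qed.

Lemma gauss_prim_real (x : R) : gauss_prim (RtoC x) = RtoC (gauss_int x).
Proof.
  assert (E : gauss_prim 0 = 0%C) by apply segment_primitive_0.
  replace (gauss_prim (RtoC x)) with (gauss_prim (RtoC x) - gauss_prim 0)%C by (rewrite E; ring).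
  rewrite <- (@is_RInt_unique C_R_CompleteNormedModule _ _ _ _ (holo_FTC _ _ 0 x holo_gauss_prim)).
  refine (is_RInt_unique (V := C_R_CompleteNormedModule)
    (fun s => Cexp (- RtoC s ^ 2)) 0 x (RtoC (gauss_int x)) _).
  apply (@is_RInt_fct_extend_pair R_NormedModule R_NormedModule).
  - apply is_RInt_ext with (fun u => exp (- u ^ 2)).
    2: apply (@RInt_correct R_CompleteNormedModule), ex_RInt_gauss.
    intros u _. rewrite <- RtoC_pow, <- RtoC_opp; simpl. rewrite cos_0; ring.
  - apply is_RInt_ext with (fun u => 0).
    + intros u _. rewrite <- RtoC_pow, <- RtoC_opp; simpl. rewrite sin_0; ring.
    + generalize (@is_RInt_const R_NormedModule 0 x 0). unfold scal; simpl; unfold mult; simpl.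
      rewrite Rmult_0_r; trivial.
Qed.

Lemma Re_sqr (z : C) : Re (z ^ 2)%C = Re z ^ 2 - Im z ^ 2.
Proof. destruct z as [a b]; simpl; ring. Qed.

(** The primitive is integrated along the vertical segment from [a] to [a + i b],
    where the modulus of the integrand is [exp (b^2 s^2 - a^2)]. With [c = |b|], the
    elementary inequality [c^2 s^2 - c^2 <= 1 + c s - c] for [0 <= s <= 1] replaces
    it by an exponential that integrates in closed form. *)
Lemma dawson_bound (a b : R) :
  Cmod (gauss_prim (a, b) - gauss_prim (RtoC a)) <= exp (b ^ 2 - a ^ 2) * exp 1.
Proof.
  assert (H := holo_FTC_line _ _ (RtoC a) (0, b) 0 1 holo_gauss_prim).
  replace (RtoC a + RtoC 1 * (0, b))%C with (a, b) in H
    by (unfold RtoC, Cplus, Cmult; simpl; f_equal; ring).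
  replace (RtoC a + RtoC 0 * (0, b))%C with (RtoC a) in H by ring.
  eapply Rle_trans.
  - refine (Cmod_RInt_le _ (fun s => exp (b ^ 2 - a ^ 2) * exp 1 * (Rabs b * exp (Rabs b * s - Rabs b)))
      0 1 _ (exp (b ^ 2 - a ^ 2) * exp 1 *
        (exp (Rabs b * 1 - Rabs b) - exp (Rabs b * 0 - Rabs b))) _ _ H _); [lra| |].
    + intros s Hs; rewrite Cmod_mult, Cmod_Cexp.
      replace (Cmod (0, b)) with (Rabs b).
      2:{ unfold Cmod; simpl; rewrite <- sqrt_Rsqr_abs; f_equal; unfold Rsqr; ring. }
      replace (exp (b ^ 2 - a ^ 2) * exp 1 * (Rabs b * exp (Rabs b * s - Rabs b))) with
        (Rabs b * (exp ((b ^ 2 - a ^ 2) + (1 + (Rabs b * s - Rabs b)))))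
        by (rewrite !exp_plus; ring).
      apply Rmult_le_compat_l; [apply Rabs_pos|]. apply exp_le.
      replace (Re (- (RtoC a + RtoC s * (0, b)) ^ 2)%C) with (s ^ 2 * b ^ 2 - a ^ 2)
        by (simpl; ring).
      rewrite <- (pow2_abs b).
      generalize (Rabs_pos b); set (c := Rabs b); intros Hc.
      replace (s ^ 2 * c ^ 2) with ((c * s) ^ 2) by ring.
      assert (Hd : 0 <= c * s <= c) by (split; nra).
      revert Hd; generalize (c * s); intros d Hd.
      (* With [d = c s], the claim [d^2 - c^2 <= 1 + d - c] reads [(c - d) (1 - (c +
         d)) <= 1]. *)
      assert ((c - d) * (1 - (c + d)) <= 1); [|nra].
      destruct (Rle_lt_dec 1 (c + d)); nra.
    + apply (@is_RInt_scal R_NormedModule (fun s => Rabs b * exp (Rabs b * s - Rabs b)) 0 1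
         (exp (b ^ 2 - a ^ 2) * exp 1)).
      apply (@is_RInt_derive R_CompleteNormedModule (fun s => exp (Rabs b * s - Rabs b))).
      * intros s _; auto_derive; [trivial|unfold Rminus; ring].
      * intros s _; apply (@ex_derive_continuous R_AbsRing R_NormedModule); auto_derive; trivial.
  - rewrite <- (Rmult_1_r (exp (b ^ 2 - a ^ 2) * exp 1)) at 2.
    apply Rmult_le_compat_l; [left; apply Rmult_lt_0_compat; apply exp_pos|].
    replace (Rabs b * 1 - Rabs b) with 0 by ring; rewrite exp_0.
    generalize (exp_pos (Rabs b * 0 - Rabs b)); lra.
Qed.

Lemma real_Lambda_bound (M : R) : exists L, 0 <= L /\ forall a, - M <= a ->
  exp (a ^ 2) * Rabs (1 - 2 / sqrt PI * gauss_int a) <= L.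
Proof.
  assert (Hs : 0 < sqrt PI) by (apply sqrt_lt_R0, PI_RGT_0).
  destruct (holo_bounded _ _ holo_gauss_prim M) as [N [HN HB]].
  (* The first summand serves [a >= 0]; the second serves [- M <= a < 0], where
     [gauss_prim] is bounded on the disc of radius [M]. *)
  exists ((2 / sqrt PI) ^ 2 + exp (M ^ 2) * (1 + 2 / sqrt PI * N)); split.
  { generalize (pow2_ge_0 (2 / sqrt PI)) (exp_pos (M ^ 2)); intros.
    assert (0 <= 2 / sqrt PI * N) by (apply Rmult_le_pos; [left; apply Rdiv_lt_0_compat; lra|exact HN]).
    nra. }
  intros a Ha.
  assert (P0 : 0 < 2 / sqrt PI) by (apply Rdiv_lt_0_compat; lra).
  destruct (Rle_lt_dec 0 a) as [H|H].
  - replace (1 - 2 / sqrt PI * gauss_int a) with (2 / sqrt PI * (sqrt PI / 2 - gauss_int a)) by (field; lra).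
    destruct (erfc_bound_pos a H) as [H1 H2].
    rewrite Rabs_pos_eq by (apply Rmult_le_pos; lra).
    apply Rle_trans with ((2 / sqrt PI) ^ 2).
    + apply Rle_trans with (exp (a ^ 2) * (2 / sqrt PI * (2 / sqrt PI * exp (- a ^ 2)))).
      * apply Rmult_le_compat_l; [left; apply exp_pos|]. apply Rmult_le_compat_l; [lra|exact H2].
      * right. rewrite exp_Ropp. field; split; apply Rgt_not_eq; first [exact Hs|apply exp_pos].
    + assert (0 <= exp (M ^ 2) * (1 + 2 / sqrt PI * N)); [|lra].
      apply Rmult_le_pos; [left; apply exp_pos|]. generalize (Rmult_le_pos _ _ (Rlt_le _ _ P0) HN); lra.
  - assert (HG : Rabs (gauss_int a) <= N).
    { rewrite <- Cmod_R, <- gauss_prim_real; apply HB.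
      rewrite Cmod_R, Rabs_left; lra. }
    assert (exp (a ^ 2) * Rabs (1 - 2 / sqrt PI * gauss_int a) <= exp (M ^ 2) * (1 + 2 / sqrt PI * N)).
    { apply Rmult_le_compat; [left; apply exp_pos|apply Rabs_pos|apply exp_le; nra|].
      eapply Rle_trans; [apply Rabs_triang|].
      rewrite Rabs_R1, Rabs_Ropp, Rabs_mult, (Rabs_pos_eq (2 / sqrt PI)) by lra.
      apply Rplus_le_compat_l, Rmult_le_compat_l; lra. }
    generalize (pow2_ge_0 (2 / sqrt PI)); lra.
Qed.

(** Split [1 - Cerf z] into its value at [a = Re z] and the increment along the
    vertical segment. The factor [exp (z^2)] has modulus [exp (a^2 - b^2)], which
    cancels the growth of the increment ([dawson_bound]) and of the real part
    ([real_Lambda_bound]). *)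
Lemma Lambda_bound (M : R) : exists L, 0 <= L /\ forall z, - M <= Re z -> Cmod (Lambda z) <= L.
Proof.
  assert (Hs : 0 < sqrt PI) by (apply sqrt_lt_R0, PI_RGT_0).
  assert (P0 : 0 < 2 / sqrt PI) by (apply Rdiv_lt_0_compat; lra).
  destruct (real_Lambda_bound M) as [L [HL H]].
  exists (L + 2 / sqrt PI * exp 1); split.
  { generalize (Rmult_lt_0_compat _ _ P0 (exp_pos 1)); lra. }
  intros [a b] Ha; simpl in Ha.
  unfold Lambda; rewrite Cmod_mult, Cmod_Cexp, Re_sqr; simpl Re; simpl Im.
  rewrite Cerf_gauss_prim.
  replace (1 - RtoC (2 / sqrt PI) * gauss_prim (a, b))%C with
    (RtoC (1 - 2 / sqrt PI * gauss_int a)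
     - RtoC (2 / sqrt PI) * (gauss_prim (a, b) - gauss_prim (RtoC a)))%C.
  2:{ rewrite gauss_prim_real, RtoC_minus, (RtoC_mult (2 / sqrt PI) (gauss_int a)); ring. }
  eapply Rle_trans; [apply Rmult_le_compat_l; [left; apply exp_pos|apply Cmod_minus_le]|].
  rewrite Rmult_plus_distr_l; apply Rplus_le_compat.
  - eapply Rle_trans; [|apply (H a Ha)]. rewrite Cmod_R.
    apply Rmult_le_compat_r; [apply Rabs_pos|]. apply exp_le; generalize (pow2_ge_0 b); lra.
  - rewrite Cmod_mult, Cmod_R, (Rabs_pos_eq (2 / sqrt PI)) by lra.
    apply Rle_trans with (exp (a ^ 2 - b ^ 2) * (2 / sqrt PI * (exp (b ^ 2 - a ^ 2) * exp 1))).
    + apply Rmult_le_compat_l; [left; apply exp_pos|]. apply Rmult_le_compat_l; [lra|].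
      apply dawson_bound.
    + right. replace (b ^ 2 - a ^ 2) with (- (a ^ 2 - b ^ 2)) by ring.
      rewrite exp_Ropp; field; split; apply Rgt_not_eq; first [exact Hs|apply exp_pos].
Qed.

(** * Rotation of half-line integrals *)

Lemma filterlim_C_p_infty (f : R -> C) (l : C) :
  (forall eps, 0 < eps -> exists M, forall r, M < r -> Cmod (f r - l) < eps) <->
  filterlim f (Rbar_locally p_infty) (@locally C_R_NormedModule l).
Proof.
  split.
  - intros H.
    apply (proj2 (@filterlim_locally_ball_norm _ R_AbsRing C_R_NormedModule _ _ f l)).
    intros eps; destruct (H eps (cond_pos eps)) as [M HM]; exists M; intros r Hr.
    unfold ball_norm; rewrite norm_Cmod; apply HM, Hr.
  - intros H eps He.
    destruct (proj1 (@filterlim_locally_ball_norm _ R_AbsRing C_R_NormedModule _ _ f l) H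
      (mkposreal eps He)) as [M HM].
    exists M; intros r Hr; specialize (HM r Hr).
    unfold ball_norm in HM; rewrite norm_Cmod in HM; exact HM.
Qed.

Lemma exp_cauchy_limit (f : R -> C) (W : R) : 0 <= W ->
  (forall a b, 0 <= a <= b -> Cmod (f b - f a) <= W * exp (- a)) ->
  exists l, filterlim f (Rbar_locally p_infty) (@locally C_R_NormedModule l).
Proof.
  intros HW H.
  apply (proj1 (@filterlim_locally_cauchy R C_R_CompleteNormedModule (Rbar_locally p_infty) _ f)).
  intros eps; exists (fun r => W / eps < r); split.
  { exists (W / eps); trivial. }
  assert (He := cond_pos eps).
  assert (Hm : 0 <= W / eps) by (apply Rdiv_le_0_compat; lra).
  assert (Hc : forall a b, W / eps < a -> a <= b -> Cmod (f b - f a) < eps).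
  { intros a b Ha Hab. eapply Rle_lt_trans; [apply H; lra|].
    rewrite exp_Ropp. apply Rlt_div_l; [apply exp_pos|].
    apply Rlt_div_l in Ha; [|exact He].
    generalize (exp_ineq1_le a); intros; nra. }
  (* The hypothesis compares ordered pairs only, hence the case distinction below.
     *)
  intros u v Hu Hv; apply (@norm_compat1 R_AbsRing C_R_NormedModule (f u) (f v)).
  rewrite norm_Cmod; change (Cmod (f v - f u) < eps).
  destruct (Rle_lt_dec u v); [auto|]. rewrite Cmod_minus_sym; apply Hc; lra.
Qed.

Lemma filterlim_Cmod_le (f : R -> C) (l : C) (c : R) :
  filterlim f (Rbar_locally p_infty) (@locally C_R_NormedModule l) ->
  (forall r, 0 <= r -> Cmod (f r) <= c) -> Cmod l <= c.
Proof.
  intros H Hc; apply Rnot_lt_le; intros Hl.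
  destruct (proj2 (filterlim_C_p_infty f l) H (Cmod l - c)) as [M HM]; [lra|].
  assert (HM1 := HM (Rmax 0 M + 1)); assert (Hc1 := Hc (Rmax 0 M + 1)).
  generalize (Rmax_l 0 M) (Rmax_r 0 M); intros.
  specialize (HM1 ltac:(lra)); specialize (Hc1 ltac:(lra)).
  rewrite Cmod_minus_sym in HM1.
  generalize (Cmod_sub_bound (f (Rmax 0 M + 1)) l); lra.
Qed.

Lemma Cmod_diag (s : R) : 0 <= s -> Cmod (s, s) <= 2 * s.
Proof.
  intros Hs; unfold Cmod; simpl.
  rewrite <- (sqrt_Rsqr (2 * s)) by lra. apply sqrt_le_1_alt; unfold Rsqr; nra.
Qed.

Lemma complete_square (d p s : R) : 0 < d -> - d * (s * s) + p * s <= (p + 1) ^ 2 / (4 * d) - s.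
Proof.
  intros Hd. 
  assert (0 <= (p + 1) ^ 2 / (4 * d) - s - (- d * (s * s) + p * s)); [|lra].
  replace ((p + 1) ^ 2 / (4 * d) - s - (- d * (s * s) + p * s)) with
    ((2 * d * s - (p + 1)) ^ 2 / (4 * d)) by (field; lra).
  apply Rdiv_le_0_compat; [apply pow2_ge_0|lra].
Qed.

Lemma is_RInt_exp (q a b : R) : is_RInt (fun s => q * exp (q * s)) a b (exp (q * b) - exp (q * a)).
Proof.
  apply (@is_RInt_derive R_CompleteNormedModule (fun s => exp (q * s))).
  - intros s _; auto_derive; [trivial|ring].
  - intros s _; apply (@ex_derive_continuous R_AbsRing R_NormedModule); auto_derive; trivial.
Qed.

(** The shape of the bound for the Green's function: decay through [Re z Im z] only,
    hence none on the real axis and Gaussian decay on the diagonal. *)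
Definition quadrant_decay (Cg d m : R) (G : C -> C) : Prop :=
  forall a b, 0 <= a -> 0 <= b -> Cmod (G (a, b)) <= Cg * exp (- d * (a * b) + m * b).

(** The constant that results from [- d s^2 + (m + p) s <= (m + p + 1)^2 / (4 d) -
    s]; the factor 2 bounds the length [|1 + i|] of the direction of the ray. *)
Definition ray_const (Cg d m p : R) : R := 2 * Cg * exp ((m + p + 1) ^ 2 / (4 * d)).

Lemma ray_const_ge_0 (Cg d m p : R) : 0 <= Cg -> 0 <= ray_const Cg d m p.
Proof. intros H; apply Rmult_le_pos; [lra|left; apply exp_pos]. Qed.

(** Completing the square turns the Gaussian decay on the ray into the integrable
    [exp (- s)], whatever the exponential growth of [F]. *)
Lemma ray_increment (G F : C -> C) (Cg d m A p a b : R) :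
  entire G -> 0 <= Cg -> 0 < d -> quadrant_decay Cg d m G -> entire F -> 0 <= A -> 0 <= a <= b ->
  (forall s, 0 <= s -> Cmod (F (s, s)) <= A * exp (p * s)) ->
  Cmod (segment_primitive (fun z => G z * F z)%C (b, b)
        - segment_primitive (fun z => G z * F z)%C (a, a))
    <= A * ray_const Cg d m p * exp (- a).
Proof.
  intros hG hCg hd hGb HF HA Hab HFb.
  destruct (entire_mult _ _ hG HF) as [h' Hh].
  assert (I := holo_FTC_line _ _ 0 (1, 1) a b (holo_segment_primitive _ _ Hh)).
  assert (E : forall s : R, (0 + RtoC s * (1, 1))%C = (s, s)).
  { intros s; unfold RtoC, Cplus, Cmult; simpl; f_equal; ring. }
  rewrite !E in I.
  set (K := A * ray_const Cg d m p).
  assert (HK : 0 <= K).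
  { apply Rmult_le_pos; [exact HA|apply ray_const_ge_0, hCg]. }
  apply Rle_trans with (- K * (exp (-1 * b) - exp (-1 * a))).
  - refine (Cmod_RInt_le _ (fun s => - K * (-1 * exp (-1 * s))) a b _ _ _ _ I _); [lra| |].
    + intros s Hs; cbv beta; rewrite E, !Cmod_mult.
      replace (- K * (-1 * exp (-1 * s))) with
        (2 * (Cg * exp ((m + p + 1) ^ 2 / (4 * d) - s) * A)).
      2:{ unfold Rminus; rewrite exp_plus; unfold K, ray_const.
          replace (-1 * s) with (- s) by ring; ring. }
      apply Rmult_le_compat; try apply Cmod_ge_0.
      * apply Rmult_le_pos; apply Cmod_ge_0.
      * replace 2 with (2 * 1) by ring; apply Cmod_diag; lra.
      * apply Rle_trans with (Cg * exp (- d * (s * s) + m * s) * (A * exp (p * s))).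
        { apply Rmult_le_compat; try apply Cmod_ge_0; [apply hGb; lra|apply HFb; lra]. }
        replace (Cg * exp (- d * (s * s) + m * s) * (A * exp (p * s)))
          with (Cg * exp (- d * (s * s) + (m + p) * s) * A).
        2:{ replace (- d * (s * s) + (m + p) * s) with
              ((- d * (s * s) + m * s) + p * s) by ring. rewrite (exp_plus _ (p * s)); ring. }
        apply Rmult_le_compat_r; [exact HA|]. apply Rmult_le_compat_l; [exact hCg|].
        apply exp_le, complete_square, hd.
    + apply (@is_RInt_scal R_NormedModule (fun s => -1 * exp (-1 * s)) a b (- K)), is_RInt_exp.
  - replace (-1 * a) with (- a) by ring.
    generalize (exp_pos (-1 * b)); intros; nra.
Qed.

(** At height [s] above the point [r] the integrand is at most [Cg A exp (- q s)]
    with [q = d r - m - p], so its integral is at most [Cg A / q]. *)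
Lemma vertical_side_vanishes (G F : C -> C) (Cg d m A p : R) :
  entire G -> 0 <= Cg -> 0 < d -> quadrant_decay Cg d m G -> entire F -> 0 <= A ->
  (forall z, Cmod (F z) <= A * exp (p * Rabs (Im z))) ->
  forall eps, 0 < eps -> exists M, forall r, M < r ->
  Cmod (segment_primitive (fun z => G z * F z)%C (r, r)
        - segment_primitive (fun z => G z * F z)%C (RtoC r)) < eps.
Proof.
  intros hG hCg hd hGb HF HA HFb eps He.
  destruct (entire_mult _ _ hG HF) as [h' Hh].
  (* This choice makes [q = d r - m - p] exceed [Cg A / eps], that is [Cg A / q <
     eps]. *)
  exists (Rmax 0 ((m + p + Cg * A / eps) / d)); intros r Hr.
  assert (Hr0 : 0 < r) by (eapply Rle_lt_trans; [apply Rmax_l|exact Hr]).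
  assert (Hr1 : Cg * A / eps < d * r - m - p).
  { assert (Hr1 : (m + p + Cg * A / eps) / d < r) by (eapply Rle_lt_trans; [apply Rmax_r|exact Hr]).
    apply Rlt_div_l in Hr1; [lra|exact hd]. }
  set (q := d * r - m - p) in *.
  assert (HCA : 0 <= Cg * A) by (apply Rmult_le_pos; assumption).
  assert (Hq0 : 0 <= Cg * A / eps) by (apply Rdiv_le_0_compat; assumption).
  assert (I := holo_FTC_line _ _ (RtoC r) (0, 1) 0 r (holo_segment_primitive _ _ Hh)).
  assert (E : forall s : R, (RtoC r + RtoC s * (0, 1))%C = (r, s)).
  { intros s; unfold RtoC, Cplus, Cmult; simpl; f_equal; ring. }
  rewrite !E in I.
  apply Rle_lt_trans with (- (Cg * A / q) * (exp (- q * r) - exp (- q * 0))).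
  - refine (Cmod_RInt_le _ (fun s => - (Cg * A / q) * (- q * exp (- q * s))) 0 r _ _ _ _ I _); [lra| |].
    + intros s Hs; cbv beta; rewrite E, !Cmod_mult.
      replace (Cmod (0, 1)) with 1.
      2:{ unfold Cmod; simpl. replace (0 * (0 * 1) + 1 * (1 * 1)) with 1 by ring. now rewrite sqrt_1. }
      replace (- (Cg * A / q) * (- q * exp (- q * s))) with
        (1 * (Cg * exp (- d * (r * s) + m * s) * (A * exp (p * s)))).
      2:{ transitivity (Cg * A * exp (- q * s)); [|field; lra].
          replace (- q * s) with ((- d * (r * s) + m * s) + p * s) by (unfold q; ring).
          rewrite (exp_plus _ (p * s)); ring. }
      apply Rmult_le_compat_l; [lra|].
      apply Rmult_le_compat; try apply Cmod_ge_0; [apply hGb; lra|].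
      generalize (HFb (r, s)); simpl; rewrite Rabs_pos_eq; [trivial|lra].
    + apply (@is_RInt_scal R_NormedModule (fun s => - q * exp (- q * s)) 0 r (- (Cg * A / q))), is_RInt_exp.
  - rewrite Rmult_0_r, exp_0.
    assert (Hq : Cg * A / q < eps).
    { apply Rlt_div_l; [lra|]. apply Rlt_div_l in Hr1; [lra|exact He]. }
    assert (0 <= Cg * A / q) by (apply Rdiv_le_0_compat; lra).
    generalize (exp_pos (- q * r)); intros; nra.
Qed.

(** The truncated integral on the half-line up to [r] and the one on the ray up to
    [(1 + i) r] differ by the vertical side, so they have the same limit. Existence
    uses the bound of [F] through [Im z], without which the vertical side need not
    vanish; the estimate of the limit is read on the ray and so needs only
    exponential growth. *)
Lemma half_line_limit (G F : C -> C) (Cg d m A p : R) :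
  entire G -> 0 <= Cg -> 0 < d -> quadrant_decay Cg d m G -> entire F -> 0 <= A ->
  (forall z, Cmod (F z) <= A * exp (p * Rabs (Im z))) ->
  exists l,
    filterlim (fun r => segment_primitive (fun z => G z * F z)%C (RtoC r))
      (Rbar_locally p_infty) (@locally C_R_NormedModule l) /\
    forall eps B, 0 <= eps -> 0 <= B ->
      (forall z, Cmod (F z) <= eps * exp (B * Cmod z)) ->
      Cmod l <= eps * ray_const Cg d m (2 * B).
Proof.
  intros hG hCg hd hGb HF HA HFb.
  destruct (exp_cauchy_limit (fun r => segment_primitive (fun z => G z * F z)%C (r, r))
    (A * ray_const Cg d m p)) as [l Hl].
  { apply Rmult_le_pos; [exact HA|apply ray_const_ge_0, hCg]. }
  { intros a b Hab; apply ray_increment; auto.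
    intros s Hs; generalize (HFb (s, s)); simpl; rewrite Rabs_pos_eq by lra; trivial. }
  exists l; split.
  - apply filterlim_C_p_infty; intros eps He.
    destruct (proj2 (filterlim_C_p_infty _ _) Hl (eps / 2)) as [M1 H1]; [lra|].
    destruct (vertical_side_vanishes G F Cg d m A p hG hCg hd hGb HF HA HFb (eps / 2)) as [M2 H2]; [lra|].
    exists (Rmax M1 M2); intros r Hr.
    specialize (H1 r (Rle_lt_trans _ _ _ (Rmax_l M1 M2) Hr)).
    specialize (H2 r (Rle_lt_trans _ _ _ (Rmax_r M1 M2) Hr)).
    rewrite Cmod_minus_sym in H2.
    replace (segment_primitive (fun z => G z * F z) (RtoC r) - l)%C with
      ((segment_primitive (fun z => G z * F z) (RtoC r) - segment_primitive (fun z => G z * F z) (r, r))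
       + (segment_primitive (fun z => G z * F z) (r, r) - l))%C by ring.
    eapply Rle_lt_trans; [apply Cmod_triangle|lra].
  - intros eps B He HB Hb.
    apply (filterlim_Cmod_le _ _ _ Hl); intros r Hr.
    generalize (ray_increment G F Cg d m eps (2 * B) 0 r hG hCg hd hGb HF He (conj (Rle_refl 0) Hr)).
    rewrite Ropp_0, exp_0, Rmult_1_r. 
    change (0, 0) with (RtoC 0); rewrite segment_primitive_0.
    replace (segment_primitive (fun z => G z * F z) (r, r) - 0)%C
      with (segment_primitive (fun z => G z * F z)%C (r, r)) by ring.
    intros K; apply K; clear K.
    intros s Hs; eapply Rle_trans; [apply Hb|].
    apply Rmult_le_compat_l; [exact He|]. apply exp_le.
    replace (2 * B * s) with (B * (2 * s)) by ring.
    apply Rmult_le_compat_l; [exact HB|apply Cmod_diag, Hs].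
Qed.

Lemma is_RInt_gen_right (f P : R -> C) (l : C) :
  (forall r, 0 < r -> @is_RInt C_R_NormedModule f 0 r (P r)) ->
  filterlim P (Rbar_locally p_infty) (@locally C_R_NormedModule l) ->
  @is_RInt_gen C_R_NormedModule f (at_point 0) (Rbar_locally p_infty) l.
Proof.
  intros HP Hl Q HQ. destruct (Hl Q HQ) as [M HM].
  apply (Filter_prod _ _ _ (fun a => a = 0) (fun r => Rmax 0 M < r)).
  - reflexivity.
  - exists (Rmax 0 M); trivial.
  - intros a r -> Hr; simpl; exists (P r); split.
    + apply HP. eapply Rle_lt_trans; [apply Rmax_l|exact Hr].
    + apply HM. eapply Rle_lt_trans; [apply Rmax_r|exact Hr].
Qed.

Lemma is_RInt_gen_left (f P : R -> C) (l : C) :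
  (forall r, 0 < r -> @is_RInt C_R_NormedModule f (- r) 0 (P r)) ->
  filterlim P (Rbar_locally p_infty) (@locally C_R_NormedModule l) ->
  @is_RInt_gen C_R_NormedModule f (Rbar_locally m_infty) (at_point 0) l.
Proof.
  intros HP Hl Q HQ. destruct (Hl Q HQ) as [M HM].
  apply (Filter_prod _ _ _ (fun r => r < - Rmax 0 M) (fun a => a = 0)).
  - exists (- Rmax 0 M); trivial.
  - reflexivity.
  - intros r a Hr ->; simpl; exists (P (- r)); split.
    + rewrite <- (Ropp_involutive r) at 1. apply HP. generalize (Rmax_l 0 M); lra.
    + apply HM. generalize (Rmax_r 0 M); lra.
Qed.

(** * The Green's function in the closed first quadrant *)

Lemma eta_bound (alpha beta : C) :
  exists E, 0 <= E /\ forall x y, Cmod (eta alpha beta x y) <= E.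
Proof.
  exists (Rabs (1 / sqrt (1 - Re alpha ^ 2)) * (Cmod alpha + Cmod beta)).
  assert (HP : 0 <= Rabs (1 / sqrt (1 - Re alpha ^ 2)) * (Cmod alpha + Cmod beta)).
  { apply Rmult_le_pos; [apply Rabs_pos|]. generalize (Cmod_ge_0 alpha) (Cmod_ge_0 beta); lra. }
  split; [exact HP|].
  assert (HI : Rabs (Im alpha) <= Cmod alpha).
  { eapply Rle_trans; [|apply Rmax_Cmod]. apply Rmax_r. }
  assert (HC : Cmod Ci = 1).
  { unfold Cmod, Ci; simpl. replace (0 * (0 * 1) + 1 * (1 * 1)) with 1 by ring. apply sqrt_1. }
  intros x y; unfold eta.
  generalize (Cmod_ge_0 alpha) (Cmod_ge_0 beta); intros.
  destruct (Req_dec_T _ _); [rewrite Cmod_0; exact HP|].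
  rewrite Cmod_mult, Cmod_R; apply Rmult_le_compat_l; [apply Rabs_pos|].
  destruct (Rlt_dec 0 x), (Rlt_dec 0 y);
    rewrite ?Cmod_mult, ?Cmod_opp, ?Cmod_conj, ?HC, ?Cmod_R, ?Rabs_Ropp; lra.
Qed.

Lemma Theta_bound x : Rabs (Theta x) <= 1.
Proof. unfold Theta; destruct (Rlt_dec 0 x); rewrite ?Rabs_R0, ?Rabs_R1; lra. Qed.

Lemma sign_bound x : Rabs (sign x) <= 1.
Proof.
  destruct (Rtotal_order x 0) as [H|[->|H]].
  - rewrite sign_eq_m1 by exact H. rewrite Rabs_left; lra.
  - rewrite sign_0, Rabs_R0; lra.
  - rewrite sign_eq_1 by exact H. rewrite Rabs_R1; lra.
Qed.

Lemma mu_bound (phi : R) (alpha beta : C) : exists N, 0 <= N /\ forall x y,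
  Cmod (mu_plus phi alpha beta x y) <= N /\ Cmod (mu_minus phi alpha beta x y) <= N /\
  Cmod (mu_0 phi alpha beta x y) <= N.
Proof.
  destruct (eta_bound alpha beta) as [E [HE H]].
  exists ((1 + Rabs (omega_plus phi alpha) + Rabs (omega_minus phi alpha)) * (1 + E)).
  generalize (Rabs_pos (omega_plus phi alpha)) (Rabs_pos (omega_minus phi alpha)); intros Hp Hm.
  assert (HN : 1 + E <= (1 + Rabs (omega_plus phi alpha) + Rabs (omega_minus phi alpha)) * (1 + E)) by nra.
  split; [lra|]; intros x y.
  assert (K : forall w (v : C), Cmod v <= 1 + E ->
    Rabs w <= Rabs (omega_plus phi alpha) + Rabs (omega_minus phi alpha) ->
    Cmod (RtoC (- (w / 2)) * v) <=
      (1 + Rabs (omega_plus phi alpha) + Rabs (omega_minus phi alpha)) * (1 + E)).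
  { intros w v Hv Hw; rewrite Cmod_mult, Cmod_R, Rabs_Ropp.
    apply Rmult_le_compat; [apply Rabs_pos|apply Cmod_ge_0| |exact Hv].
    unfold Rdiv; rewrite Rabs_mult, (Rabs_pos_eq (/ 2)) by lra.
    generalize (Rabs_pos w); lra. }
  assert (V1 : forall u, Cmod (RtoC (Theta u)) <= 1) by (intros; rewrite Cmod_R; apply Theta_bound).
  assert (V2 : forall u, Cmod (RtoC (Theta u) + eta alpha beta x y) <= 1 + E).
  { intros u; eapply Rle_trans; [apply Cmod_triangle|]. generalize (V1 u) (H x y); lra. }
  assert (V3 : forall u, Cmod (RtoC (Theta u) - eta alpha beta x y) <= 1 + E).
  { intros u; eapply Rle_trans; [apply Cmod_minus_le|]. generalize (V1 u) (H x y); lra. }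
  unfold mu_plus, mu_minus, mu_0.
  split; [|split]; destruct (case_of phi alpha); rewrite ?Cmod_0; try lra;
    try (apply K; [auto|lra]).
  - rewrite Cmod_R; generalize (sign_bound (x * y)); lra.
  - rewrite Cmod_minus_sym; eapply Rle_trans; [apply V3|exact HN].
  - rewrite Cmod_R, Rabs_left; lra.
Qed.

Definition gauss (t : R) (z : C) : C := Cexp (- (z ^ 2 / (4 * Ci * RtoC t))).

(** [- z^2 / (4 i t) = i z^2 / (4 t)], and the imaginary part of [z^2] is [2 Re z Im
    z]. *)
Lemma Cmod_gauss (t : R) (z : C) : 0 < t -> Cmod (gauss t z) = exp (- (Re z * Im z) / (2 * t)).
Proof.
  intros Ht; unfold gauss; rewrite Cmod_Cexp; f_equal.
  destruct z as [a b].
  replace (- ((a, b) ^ 2 / (4 * Ci * RtoC t)))%C with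
    (RtoC (/ (4 * t)) * (Ci * (a, b) ^ 2))%C.
  - unfold Ci, RtoC; simpl; field; lra.
  - rewrite RtoC_inv, RtoC_mult by lra.
    assert (RtoC t <> 0%C) by (intros E; apply RtoC_inj in E; lra).
    assert (Ci <> 0%C) by (unfold Ci, RtoC; intros E; injection E; lra).
    assert (E4 : RtoC 4 <> 0%C) by (intros K; apply RtoC_inj in K; lra).
    assert (E : (/ Ci)%C = (- Ci)%C).
    { unfold Ci, Cinv, Copp; simpl; f_equal; field. }
    replace ((a, b) ^ 2 / (4 * Ci * RtoC t))%C
      with ((a, b) ^ 2 * / Ci / (4 * RtoC t))%C by (field; auto).
    rewrite E; field; auto.
Qed.

Lemma sqrt_i_diag (t : R) : sqrt_i t = (sqrt t / sqrt 2, sqrt t / sqrt 2).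
Proof.
  unfold sqrt_i, Cexp, Ci, RtoC, Cmult; simpl.
  replace (0 * (PI / 4) - 1 * 0) with 0 by ring.
  replace (0 * 0 + 1 * (PI / 4)) with (PI / 4) by ring.
  rewrite exp_0, cos_PI4, sin_PI4; unfold Rdiv; f_equal; ring.
Qed.

Lemma Cmod_sqrt_i (t : R) : 0 <= t -> Cmod (sqrt_i t) = sqrt t.
Proof.
  intros Ht; unfold sqrt_i; rewrite Cmod_mult, Cmod_R, Cmod_Cexp.
  replace (Re (Ci * RtoC (PI / 4))%C) with 0 by (simpl; ring).
  rewrite exp_0, Rabs_pos_eq by apply sqrt_pos; ring.
Qed.

(** Dividing by [sqrt_i t] rotates by [- PI / 4], which sends the first quadrant
    into the right half-plane; only the shift [w sqrt_i t] can make the real part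
    negative. *)
Lemma Re_Lambda_arg (t T w r0 a b : R) : 0 < t <= T -> 0 <= r0 -> 0 <= a -> 0 <= b ->
  - (Rabs w * (T + 1)) <=
  Re ((RtoC r0 + (a, b)) / (2 * sqrt_i t) + RtoC w * sqrt_i t)%C.
Proof.
  intros [Ht HT] Hr Ha Hb; rewrite sqrt_i_diag.
  assert (H2 : 0 < sqrt 2) by (apply sqrt_lt_R0; lra).
  assert (Hq : 0 < sqrt t / sqrt 2).
  { apply Rdiv_lt_0_compat; [apply sqrt_lt_R0; lra|exact H2]. }
  assert (Hq1 : sqrt t / sqrt 2 <= T + 1).
  { apply Rle_div_l; [exact H2|].
    assert (1 <= sqrt 2) by (rewrite <- sqrt_1 at 1; apply sqrt_le_1_alt; lra).
    assert (sqrt t <= T + 1).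
    { rewrite <- (sqrt_Rsqr (T + 1)) by lra. apply sqrt_le_1_alt; unfold Rsqr; nra. }
    nra. }
  revert Hq Hq1; generalize (sqrt t / sqrt 2); intros q Hq Hq1.
  replace ((RtoC r0 + (a, b)) / (2 * (q, q)))%C with
    (((r0 + a + b) / (4 * q), (b - r0 - a) / (4 * q)) : C).
  2:{ unfold Cdiv, Cinv, Cplus, Cmult, RtoC; simpl; f_equal; field; split; nra. }
  simpl. 
  assert (0 <= (r0 + a + b) / (4 * q)) by (apply Rdiv_le_0_compat; lra).
  assert (- (Rabs w * (T + 1)) <= w * q).
  { generalize (Rabs_pos w) (Rle_abs (- w)); rewrite Rabs_Ropp; intros; nra. }
  lra.
Qed.

(** The entire extension, from [y > 0], of [y |-> Green t x (s y)] with [s = 1] or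
    [s = -1]. The two signs treat the two half-lines; [s] also serves as the
    representative of the sign of the second argument in the coefficients. *)
Definition half_Green (phi : R) (alpha beta : C) (t x s : R) (z : C) : C :=
  let Lam (w : R) := Lambda ((RtoC (Rabs x) + z) / (2 * sqrt_i t) + RtoC w * sqrt_i t) in
  ((mu_plus phi alpha beta x s * Lam (omega_plus phi alpha)
    + mu_minus phi alpha beta x s * Lam (omega_minus phi alpha)) * gauss t (RtoC (Rabs x) + z)
   + 1 / (2 * sqrt_i (PI * t))
     * (mu_0 phi alpha beta x s * gauss t (RtoC (Rabs x) + z) + gauss t (RtoC (s * x) - z)))%C.

Lemma entire_half_Green phi alpha beta t x s : entire (half_Green phi alpha beta t x s).
Proof.
  assert (HG : forall f, entire f -> entire (fun z => gauss t (f z))).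
  { intros f Hf; apply entire_Cexp, entire_opp, entire_div, entire_pow, Hf. }
  assert (Hp : entire (fun z => RtoC (Rabs x) + z)%C).
  { apply entire_plus; [apply entire_const|apply entire_id]. }
  assert (HL : forall w, entire (fun z =>
      Lambda ((RtoC (Rabs x) + z) / (2 * sqrt_i t) + RtoC w * sqrt_i t))%C).
  { intros w; apply (entire_comp Lambda); [apply entire_Lambda|].
    apply entire_plus; [apply entire_div, Hp|apply entire_const]. }
  apply entire_plus.
  - apply entire_mult; [|apply HG, Hp].
    apply entire_plus; apply entire_mult; auto using entire_const.
  - apply entire_mult; [apply entire_const|]. apply entire_plus.
    + apply entire_mult; [apply entire_const|apply HG, Hp].
    + apply HG, entire_minus; [apply entire_const|apply entire_id].
Qed.

(** Each Gaussian has its centre [- |x|] or [s x] at distance at most [X] from 0, so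
    it is at most [exp (- (a b - X b) / (2 t))]; the remaining factors are bounded
    uniformly in [t] and [x]. *)
Lemma half_Green_decay (phi : R) (alpha beta : C) (t0 T X : R) : 0 < t0 <= T -> 0 <= X ->
  exists Cg, 0 <= Cg /\ forall t x s, t0 <= t <= T -> Rabs x <= X -> Rabs s = 1 ->
  quadrant_decay Cg (/ (2 * T)) (X / (2 * t0)) (half_Green phi alpha beta t x s).
Proof.
  intros Ht0 HX.
  destruct (mu_bound phi alpha beta) as [N [HN HM]].
  destruct (Lambda_bound (Rabs (omega_plus phi alpha) * (T + 1))) as [L1 [HL1 HB1]].
  destruct (Lambda_bound (Rabs (omega_minus phi alpha) * (T + 1))) as [L2 [HL2 HB2]].
  set (b0 := / (2 * sqrt (PI * t0))).
  assert (HPI := PI_RGT_0).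
  assert (Hs0 : 0 < sqrt (PI * t0)) by (apply sqrt_lt_R0; nra).
  assert (Hb0 : 0 < b0) by (apply Rinv_0_lt_compat; lra).
  exists (N * L1 + N * L2 + b0 * (N + 1)); split.
  { generalize (Rmult_le_pos _ _ HN HL1) (Rmult_le_pos _ _ HN HL2); intros; nra. }
  intros t x s Ht Hx Hs a b Ha Hb.
  set (E := exp (- / (2 * T) * (a * b) + X / (2 * t0) * b)).
  assert (HE : 0 < E) by apply exp_pos.
  assert (G : forall z : C, a * b - X * b <= Re z * Im z -> Cmod (gauss t z) <= E).
  { intros z Hz; rewrite Cmod_gauss by lra; apply exp_le.
    apply Rle_trans with (- (a * b - X * b) / (2 * t)).
    { apply Rmult_le_compat_r; [left; apply Rinv_0_lt_compat; lra|lra]. }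
    assert (/ (2 * T) <= / (2 * t)) by (apply Rinv_le_contravar; lra).
    assert (/ (2 * t) <= / (2 * t0)) by (apply Rinv_le_contravar; lra).
    assert (0 <= a * b) by nra. assert (0 <= X * b) by nra.
    unfold Rdiv. generalize dependent (/ (2 * t)). generalize (/ (2 * T)) (/ (2 * t0)).
    intros; nra. }
  assert (G1 : Cmod (gauss t (RtoC (Rabs x) + (a, b))) <= E).
  { apply G; simpl. generalize (Rabs_pos x); intros; nra. }
  assert (G2 : Cmod (gauss t (RtoC (s * x) - (a, b))) <= E).
  { apply G; simpl.
    assert (s * x <= X).
    { eapply Rle_trans; [apply Rle_abs|]. rewrite Rabs_mult, Hs; lra. }
    nra. }
  destruct (HM x s) as [M1 [M2 M3]].
  assert (HR : forall w, - (Rabs w * (T + 1)) <=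
    Re ((RtoC (Rabs x) + (a, b)) / (2 * sqrt_i t) + RtoC w * sqrt_i t)%C).
  { intros w; apply Re_Lambda_arg; auto; [lra|apply Rabs_pos]. }
  unfold half_Green.
  eapply Rle_trans; [apply Cmod_triangle|].
  rewrite Rmult_plus_distr_r; apply Rplus_le_compat; rewrite Cmod_mult.
  - apply Rmult_le_compat; try apply Cmod_ge_0; [|exact G1].
    eapply Rle_trans; [apply Cmod_triangle|].
    rewrite !Cmod_mult; apply Rplus_le_compat; apply Rmult_le_compat; auto using Cmod_ge_0.
  - rewrite Rmult_assoc; apply Rmult_le_compat; try apply Cmod_ge_0.
    + assert (Hst : 0 < sqrt (PI * t)) by (apply sqrt_lt_R0; nra).
      assert (Hn : (2 * sqrt_i (PI * t))%C <> 0%C).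
      { intros K; apply (f_equal Cmod) in K.
        rewrite Cmod_mult, Cmod_0, Cmod_R, Cmod_sqrt_i, Rabs_pos_eq in K by nra. lra. }
      unfold Cdiv; rewrite Cmult_1_l, Cmod_inv by exact Hn.
      rewrite Cmod_mult, Cmod_R, Cmod_sqrt_i, Rabs_pos_eq by nra.
      apply Rinv_le_contravar; [lra|].
      apply Rmult_le_compat_l; [lra|]. apply sqrt_le_1_alt; nra.
    + eapply Rle_trans; [apply Cmod_triangle|].
      rewrite Rmult_plus_distr_r, Rmult_1_l; apply Rplus_le_compat; [|exact G2].
      rewrite Cmod_mult; apply Rmult_le_compat; auto using Cmod_ge_0.
Qed.

Lemma Theta_scale x y : 0 < y -> Theta (x * y) = Theta x.
Proof.
  intros Hy; unfold Theta; destruct (Rlt_dec 0 (x * y)), (Rlt_dec 0 x); auto; exfalso; nra.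
Qed.

Lemma eta_scale alpha beta x s y : 0 < y -> eta alpha beta x (s * y) = eta alpha beta x s.
Proof.
  intros Hy; unfold eta.
  destruct (Rlt_dec 0 (s * y)), (Rlt_dec 0 s); auto; exfalso; nra.
Qed.

Lemma sign_scale x y : 0 < y -> sign (x * y) = sign x.
Proof. intros Hy; rewrite sign_mult, (sign_eq_1 y Hy); ring. Qed.

(** The coefficients depend on the second argument through its sign only, and [x - s
    y] equals [s (s x - y)] since [s^2 = 1]. *)
Lemma Green_half_Green (phi : R) (alpha beta : C) (t x s y : R) : Rabs s = 1 -> 0 < y ->
  Green phi alpha beta t x (s * y) = half_Green phi alpha beta t x s (RtoC y).
Proof.
  intros Hs Hy; unfold Green, half_Green, gauss.
  assert (E1 : mu_plus phi alpha beta x (s * y) = mu_plus phi alpha beta x s).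
  { unfold mu_plus; rewrite <- Rmult_assoc, Theta_scale, eta_scale by exact Hy; reflexivity. }
  assert (E2 : mu_minus phi alpha beta x (s * y) = mu_minus phi alpha beta x s).
  { unfold mu_minus; rewrite <- Rmult_assoc, Theta_scale, eta_scale by exact Hy; reflexivity. }
  assert (E3 : mu_0 phi alpha beta x (s * y) = mu_0 phi alpha beta x s).
  { unfold mu_0; rewrite <- Rmult_assoc, sign_scale, Ropp_mult_distr_l, Theta_scale, eta_scale
      by exact Hy; reflexivity. }
  assert (E4 : Rabs (s * y) = y) by (rewrite Rabs_mult, Hs, Rabs_pos_eq; lra).
  assert (E5 : (x - s * y) ^ 2 = (s * x - y) ^ 2).
  { assert (H : s * s = 1) by (generalize (Rsqr_abs s); rewrite Hs; unfold Rsqr; lra).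
    replace ((x - s * y) ^ 2) with (x * x - 2 * (s * x * y) + (s * s) * (y * y)) by ring.
    replace ((s * x - y) ^ 2) with ((s * s) * (x * x) - 2 * (s * x * y) + y * y) by ring.
    rewrite H; ring. }
  rewrite E1, E2, E3, E4, E5, <- RtoC_minus, <- RtoC_plus, !RtoC_pow; reflexivity.
Qed.

(** * The wave function *)

(** What is needed of an initial datum for its improper integrals to exist and to be
    computed on the ray. *)
Definition tame (F : C -> C) : Prop :=
  entire F /\ exists A p, 0 <= A /\ 0 <= p /\
    forall z, Cmod (F z) <= A * exp (p * Rabs (Im z)).

Lemma tame_plus (F1 F2 : C -> C) : tame F1 -> tame F2 -> tame (fun z => F1 z + F2 z)%C.
Proof.
  intros [H1 [A1 [p1 [HA1 [Hp1 B1]]]]] [H2 [A2 [p2 [HA2 [Hp2 B2]]]]].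
  split; [apply entire_plus; assumption|].
  exists (A1 + A2), (p1 + p2); split; [lra|split; [lra|]]; intros z.
  eapply Rle_trans; [apply Cmod_triangle|].
  rewrite Rmult_plus_distr_r; generalize (Rabs_pos (Im z)); intros.
  apply Rplus_le_compat.
  - eapply Rle_trans; [apply B1|]. apply Rmult_le_compat_l; [exact HA1|apply exp_le; nra].
  - eapply Rle_trans; [apply B2|]. apply Rmult_le_compat_l; [exact HA2|apply exp_le; nra].
Qed.

Lemma tame_scal (a : C) (F : C -> C) : tame F -> tame (fun z => a * F z)%C.
Proof.
  intros [H [A [p [HA [Hp B]]]]]; split; [apply entire_mult; [apply entire_const|exact H]|].
  exists (Cmod a * A), p; split; [apply Rmult_le_pos; [apply Cmod_ge_0|exact HA]|split; [exact Hp|]].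
  intros z; rewrite Cmod_mult, Rmult_assoc.
  apply Rmult_le_compat_l; [apply Cmod_ge_0|apply B].
Qed.

Lemma tame_ext (F1 F2 : C -> C) : (forall z, F1 z = F2 z) -> tame F1 -> tame F2.
Proof.
  intros E [H [A [p [HA [Hp B]]]]]; split; [exact (entire_ext _ _ E H)|].
  exists A, p; repeat split; auto; intros z; rewrite <- E; apply B.
Qed.

Lemma tame_minus (F1 F2 : C -> C) : tame F1 -> tame F2 -> tame (fun z => F1 z - F2 z)%C.
Proof.
  intros H1 H2; apply (tame_ext (fun z => F1 z + (-1) * F2 z)%C); [intros; ring|].
  apply tame_plus; [exact H1|apply tame_scal, H2].
Qed.

Lemma tame_plane_wave (k : R) : tame (plane_wave k).
Proof.
  split.
  - apply (entire_Cexp (fun z => Ci * RtoC k * z)%C), entire_mult; [apply entire_const|apply entire_id].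
  - exists 1, (Rabs k); split; [lra|split; [apply Rabs_pos|]]; intros z.
    unfold plane_wave; rewrite Cmod_Cexp, Rmult_1_l; apply exp_le.
    replace (Re (Ci * RtoC k * z)%C) with (- (k * Im z)) by (destruct z; simpl; ring).
    rewrite <- Rabs_mult, <- (Rabs_Ropp (k * Im z)); apply Rle_abs.
Qed.

Lemma tame_Fourier_seq c kk n : tame (Fourier_seq c kk n).
Proof.
  enough (H : forall m, tame (fun z =>
    @sum_n C_AbelianMonoid (fun j => c n j * plane_wave (kk n j) z)%C m)) by apply H.
  induction m as [|m IH].
  - apply (tame_ext (fun z => c n 0%nat * plane_wave (kk n 0%nat) z)%C).
    + intros z; symmetry.
      apply (@sum_O C_AbelianMonoid (fun j => c n j * plane_wave (kk n j) z)%C).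
    + apply tame_scal, tame_plane_wave.
  - apply (tame_ext (fun z => @sum_n C_AbelianMonoid (fun j => c n j * plane_wave (kk n j) z)%C m
      + c n (S m) * plane_wave (kk n (S m)) z)%C).
    + intros z; symmetry.
      apply (@sum_Sn C_AbelianMonoid (fun j => c n j * plane_wave (kk n j) z)%C m).
    + apply tame_plus; [exact IH|apply tame_scal, tame_plane_wave].
Qed.

Lemma tame_sign (F : C -> C) (s : R) : Rabs s = 1 -> tame F -> tame (fun z => F (RtoC s * z)%C).
Proof.
  intros Hs [H [A [p [HA [Hp B]]]]]; split.
  - apply entire_comp; [exact H|apply entire_mult; [apply entire_const|apply entire_id]].
  - exists A, p; repeat split; auto; intros z.
    eapply Rle_trans; [apply B|].
    replace (Im (RtoC s * z)%C) with (s * Im z) by (destruct z; simpl; ring).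
    rewrite Rabs_mult, Hs, Rmult_1_l; lra.
Qed.

Definition wave_integrand phi alpha beta t x (F : C -> C) (y : R) : C :=
  (Green phi alpha beta t x y * F (RtoC y))%C.

Lemma is_RInt_half_wave phi alpha beta t x s F r : Rabs s = 1 -> entire F -> 0 < r ->
  @is_RInt C_R_NormedModule (fun y => wave_integrand phi alpha beta t x F (s * y)) 0 r
    (segment_primitive (fun z => half_Green phi alpha beta t x s z * F (RtoC s * z))%C (RtoC r)).
Proof.
  intros Hs HF Hr.
  assert (H : entire (fun z => half_Green phi alpha beta t x s z * F (RtoC s * z))%C).
  { apply entire_mult; [apply entire_half_Green|].
    apply entire_comp; [exact HF|apply entire_mult; [apply entire_const|apply entire_id]]. }
  destruct H as [h' Hh].
  assert (I := holo_FTC _ _ 0 r (holo_segment_primitive _ _ Hh)).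
  rewrite segment_primitive_0 in I. 
  match type of I with is_RInt _ _ _ (Cminus ?u (RtoC 0)) =>
    replace (Cminus u (RtoC 0)) with u in I by ring end.
  eapply is_RInt_ext; [|exact I].
  intros y; rewrite Rmin_left, Rmax_right by lra; intros Hy; simpl.
  unfold wave_integrand; rewrite Green_half_Green, RtoC_mult by (auto; lra); reflexivity.
Qed.

Lemma half_wave (phi : R) (alpha beta : C) (t0 T X : R) : 0 < t0 <= T -> 0 <= X ->
  exists Cg d m, forall t x s F, t0 <= t <= T -> Rabs x <= X -> Rabs s = 1 -> tame F ->
  exists l,
    filterlim
      (fun r => segment_primitive
        (fun z => half_Green phi alpha beta t x s z * F (RtoC s * z))%C (RtoC r))
      (Rbar_locally p_infty) (@locally C_R_NormedModule l) /\
    forall eps B, 0 <= eps -> 0 <= B ->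
      (forall z, Cmod (F z) <= eps * exp (B * Cmod z)) ->
      Cmod l <= eps * ray_const Cg d m (2 * B).
Proof.
  intros Ht0 HX.
  destruct (half_Green_decay phi alpha beta t0 T X Ht0 HX) as [Cg [HCg HD]].
  exists Cg, (/ (2 * T)), (X / (2 * t0)); intros t x s F Ht Hx Hs HF.
  destruct (tame_sign F s Hs HF) as [H [A [p [HA [Hp B]]]]].
  destruct (half_line_limit _ _ Cg (/ (2 * T)) (X / (2 * t0)) A p
    (entire_half_Green phi alpha beta t x s) HCg ltac:(apply Rinv_0_lt_compat; lra)
    (HD t x s Ht Hx Hs) H HA B) as [l [Hl Hb]].
  exists l; split; [exact Hl|].
  intros eps b He Hb0 HF2; apply (Hb eps b He Hb0).
  intros z; eapply Rle_trans; [apply HF2|].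
  rewrite Cmod_mult, Cmod_R, Hs, Rmult_1_l; lra.
Qed.

Lemma wave_half_integrals (phi : R) (alpha beta : C) (t0 T X : R) : 0 < t0 <= T -> 0 <= X ->
  exists Cg d m, forall t x F, t0 <= t <= T -> Rabs x <= X -> tame F ->
  exists l1 l2,
    @is_RInt_gen C_R_NormedModule (wave_integrand phi alpha beta t x F)
      (Rbar_locally m_infty) (at_point 0) l1 /\
    @is_RInt_gen C_R_NormedModule (wave_integrand phi alpha beta t x F)
      (at_point 0) (Rbar_locally p_infty) l2 /\
    forall eps B, 0 <= eps -> 0 <= B ->
      (forall z, Cmod (F z) <= eps * exp (B * Cmod z)) ->
      Cmod (l1 + l2) <= eps * (2 * ray_const Cg d m (2 * B)).
Proof.
  intros Ht0 HX.
  destruct (half_wave phi alpha beta t0 T X Ht0 HX) as [Cg [d [m HW]]].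
  exists Cg, d, m; intros t x F Ht Hx HF.
  assert (S1 : Rabs 1 = 1) by apply Rabs_R1.
  assert (S2 : Rabs (-1) = 1) by (rewrite Rabs_left; lra).
  destruct (HW t x (-1) F Ht Hx S2 HF) as [l1 [H1 B1]].
  destruct (HW t x 1 F Ht Hx S1 HF) as [l2 [H2 B2]].
  exists l1, l2; split; [|split].
  - refine (is_RInt_gen_left _ _ _ _ H1); intros r Hr.
    assert (I := is_RInt_half_wave phi alpha beta t x (-1) F r S2 (proj1 HF) Hr).
    apply (is_RInt_swap (V := C_R_NormedModule)) in I.
    replace r with (- - r) in I at 1 by ring.
    replace 0 with (- 0) in I at 1 by ring.
    apply (is_RInt_comp_opp (V := C_R_NormedModule)) in I.
    apply (is_RInt_opp (V := C_R_NormedModule)) in I.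
    rewrite opp_opp in I.
    eapply is_RInt_ext; [|exact I]; intros y _; simpl.
    rewrite opp_opp; f_equal; ring.
  - refine (is_RInt_gen_right _ _ _ _ H2); intros r Hr.
    assert (I := is_RInt_half_wave phi alpha beta t x 1 F r S1 (proj1 HF) Hr).
    eapply is_RInt_ext; [|exact I]; intros y _; simpl; f_equal; ring.
  - intros eps B He HB HF2; eapply Rle_trans; [apply Cmod_triangle|].
    generalize (B1 eps B He HB HF2) (B2 eps B He HB HF2); lra.
Qed.

(** The bound for the difference comes from applying [wave_half_integrals] to the
    datum [F1 - F2], whose integrals are the differences of those of [F1] and [F2].
    *)
Lemma Psi_continuous_dependence (phi : R) (alpha beta : C) (t0 T X B : R) :
  0 < t0 <= T -> 0 <= X -> 0 <= B ->
  exists S, forall t x F1 F2 eps, t0 <= t <= T -> Rabs x <= X -> tame F1 -> tame F2 -> 0 <= eps ->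
    (forall z, Cmod (F1 z - F2 z) <= eps * exp (B * Cmod z)) ->
    Cmod (Psi phi alpha beta t x F1 - Psi phi alpha beta t x F2) <= eps * S.
Proof.
  intros Ht0 HX HB.
  destruct (wave_half_integrals phi alpha beta t0 T X Ht0 HX) as [Cg [d [m HW]]].
  exists (2 * ray_const Cg d m (2 * B)); intros t x F1 F2 eps Ht Hx T1 T2 He HD.
  destruct (HW t x F1 Ht Hx T1) as [l1 [r1 [L1 [R1 _]]]].
  destruct (HW t x F2 Ht Hx T2) as [l2 [r2 [L2 [R2 _]]]].
  destruct (HW t x _ Ht Hx (tame_minus _ _ T1 T2)) as [l [r [L [Rr Hb]]]].
  assert (EL : (l1 - l2)%C = l).
  { rewrite <- (is_RInt_gen_unique (V := C_R_CompleteNormedModule) _ _ L).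
    symmetry; apply (is_RInt_gen_unique (V := C_R_CompleteNormedModule)).
    refine (is_RInt_gen_ext _ _ _ _ (is_RInt_gen_minus (V := C_R_NormedModule) _ _ _ _ L1 L2)).
    apply filter_forall; intros ab y _.
    unfold wave_integrand, minus, plus, opp; simpl.
    change (Green phi alpha beta t x y * F1 (RtoC y) - Green phi alpha beta t x y * F2 (RtoC y)
      = Green phi alpha beta t x y * (F1 (RtoC y) - F2 (RtoC y)))%C; ring. }
  assert (ER : (r1 - r2)%C = r).
  { rewrite <- (is_RInt_gen_unique (V := C_R_CompleteNormedModule) _ _ Rr).
    symmetry; apply (is_RInt_gen_unique (V := C_R_CompleteNormedModule)).
    refine (is_RInt_gen_ext _ _ _ _ (is_RInt_gen_minus (V := C_R_NormedModule) _ _ _ _ R1 R2)).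
    apply filter_forall; intros ab y _.
    unfold wave_integrand, minus, plus, opp; simpl.
    change (Green phi alpha beta t x y * F1 (RtoC y) - Green phi alpha beta t x y * F2 (RtoC y)
      = Green phi alpha beta t x y * (F1 (RtoC y) - F2 (RtoC y)))%C; ring. }
  assert (E1 : Psi phi alpha beta t x F1 = (l1 + r1)%C).
  { unfold Psi; f_equal; apply (is_RInt_gen_unique (V := C_R_CompleteNormedModule)); assumption. }
  assert (E2 : Psi phi alpha beta t x F2 = (l2 + r2)%C).
  { unfold Psi; f_equal; apply (is_RInt_gen_unique (V := C_R_CompleteNormedModule)); assumption. }
  rewrite E1, E2.
  replace (l1 + r1 - (l2 + r2))%C with (l + r)%C by (rewrite <- EL, <- ER; ring).
  apply (Hb eps B He HB HD).
Qed.

Lemma box_contains_ball (u v t x t' x' : R) :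
  Rabs (t' - t) < Rmin (t - u) (Rmin (v - t) (v - Rabs x)) ->
  Rabs (x' - x) < Rmin (t - u) (Rmin (v - t) (v - Rabs x)) ->
  u < t' /\ t' < v /\ Rabs x' < v.
Proof.
  intros H1 H2.
  generalize (Rmin_l (t - u) (Rmin (v - t) (v - Rabs x)))
    (Rmin_r (t - u) (Rmin (v - t) (v - Rabs x)))
    (Rmin_l (v - t) (v - Rabs x)) (Rmin_r (v - t) (v - Rabs x)); intros.
  assert (B1 : Rabs (t' - t) < t - u) by lra.
  assert (B2 : Rabs (t' - t) < v - t) by lra.
  assert (B3 : Rabs (x' - x) < v - Rabs x) by lra.
  apply Rabs_def2 in B1; apply Rabs_def2 in B2.
  generalize (Rabs_triang (x' - x) x); replace (x' - x + x) with x' by ring.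
  intros; repeat split; lra.
Qed.

(** The open boxes [1/(n+1) < t < n+1], [|x| < n+1] increase to the half-plane, so a
    finite subcover is contained in its largest member. *)
Lemma compact_half_plane_bounds (K : R * R -> Prop) :
  @compact_set (prod_UniformSpace R_UniformSpace R_UniformSpace) K ->
  (forall p, K p -> 0 < fst p) ->
  exists N, 1 <= N /\ forall p, K p -> / N <= fst p <= N /\ Rabs (snd p) <= N.
Proof.
  intros HK Hpos.
  destruct (HK nat (fun n p => / INR (S n) < fst p /\ fst p < INR (S n) /\ Rabs (snd p) < INR (S n)))
    as [l Hl].
  - intros n [t x] [H1 [H2 H3]]; simpl fst in *; simpl snd in *.
    assert (Hd : 0 < Rmin (t - / INR (S n)) (Rmin (INR (S n) - t) (INR (S n) - Rabs x))).
    { repeat apply Rmin_glb_lt; lra. }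
    exists (mkposreal _ Hd); intros [t' x'] [B1 B2].
    exact (box_contains_ball _ _ _ _ _ _ B1 B2).
  - intros [t x] Hp; specialize (Hpos _ Hp); simpl fst in *; simpl snd in *.
    destruct (INR_unbounded (Rmax (/ t) (Rmax t (Rabs x)))) as [n Hn].
    exists n; rewrite S_INR.
    generalize (Rmax_l (/ t) (Rmax t (Rabs x))) (Rmax_r (/ t) (Rmax t (Rabs x)))
      (Rmax_l t (Rabs x)) (Rmax_r t (Rabs x)); intros.
    repeat split; try lra.
    rewrite <- (Rinv_inv t). apply Rinv_lt_contravar; [|lra].
    assert (0 < / t) by (apply Rinv_0_lt_compat; exact Hpos).
    apply Rmult_lt_0_compat; lra.
  - assert (HN : exists N, forall n, In n l -> (n <= N)%nat).
    { clear; induction l as [|a l [N IH]]; [exists 0%nat; intros n []|].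
      exists (Nat.max a N); intros n [<-|Hn]; [apply Nat.le_max_l|].
      eapply Nat.le_trans; [apply IH, Hn|apply Nat.le_max_r]. }
    destruct HN as [N HN]; exists (INR (S N)).
    assert (P : forall n, 1 <= INR (S n)) by (intros n; rewrite S_INR; generalize (pos_INR n); lra).
    split; [apply P|]; intros p Hp.
    destruct (Hl p Hp) as [n [Hn [H1 [H2 H3]]]].
    assert (Hle : INR (S n) <= INR (S N)) by (apply le_INR; generalize (HN n Hn); lia).
    assert (Hinv : / INR (S N) <= / INR (S n)).
    { apply Rinv_le_contravar; [generalize (P n); lra|exact Hle]. }
    split; [split|]; eapply Rle_trans.
    + exact Hinv.
    + left; exact H1.
    + left; exact H2.
    + exact Hle.
    + left; exact H3.
    + exact Hle.
Qed.

Lemma sup_on_lt {T : Type} (D : T -> Prop) (f : T -> R) (u : R) :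
  Rbar_lt (sup_on D f) (Finite u) -> forall x, D x -> f x <= u.
Proof.
  intros H x Hx.
  assert (U : Rbar_le (Finite (f x)) (sup_on D f)).
  { unfold sup_on; apply (proj1 (Lub_Rbar_correct _)); exists x; auto. }
  destruct (sup_on D f); simpl in *; lra || contradiction.
Qed.

Lemma sup_on_le {T : Type} (D : T -> Prop) (f : T -> R) (u : R) :
  (forall x, D x -> f x <= u) -> Rbar_le (sup_on D f) (Finite u).
Proof.
  intros H; unfold sup_on; apply (proj2 (Lub_Rbar_correct _)).
  intros r [x [Hx ->]]; simpl; auto.
Qed.

Theorem corollary5p2
    (J : @matrix C 2 2) (phi : R) (alpha beta : C)
    (hJ : unitary J) (hparam : unitary_param J phi alpha beta)
    (c : nat -> nat -> C) (kk : nat -> nat -> R) (k : R)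
    (hF : superoscillating c kk k)
    (B : R) (hB : 0 <= B)
    (hconv : sup_tends_to_0 (fun _ : C => True)
               (fun n z => Cmod (Fourier_seq c kk n z - plane_wave k z)
                           * exp (- B * Cmod z))) :
  forall K : R * R -> Prop,
    @compact_set (prod_UniformSpace R_UniformSpace R_UniformSpace) K ->
    (forall p, K p -> 0 < fst p) ->
    sup_tends_to_0 (fun p : R * R => K p /\ snd p <> 0)
      (fun n p =>
         Cmod (Psi phi alpha beta (fst p) (snd p) (Fourier_seq c kk n)
               - Psi phi alpha beta (fst p) (snd p) (plane_wave k))).
Proof.
  intros K HK Hpos eps.
  destruct (compact_half_plane_bounds K HK Hpos) as [N [HN Hb]].
  assert (HN' : 0 < / N <= N).
  { split; [apply Rinv_0_lt_compat; lra|].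
    apply Rle_trans with 1; [|exact HN]. rewrite <- Rinv_1; apply Rinv_le_contravar; lra. }
  destruct (Psi_continuous_dependence phi alpha beta (/ N) N N B HN' ltac:(lra) hB) as [S HS].
  assert (He := cond_pos eps).
  assert (HS0 := Rabs_pos S).
  assert (Hd : 0 < eps / (2 * (Rabs S + 1))) by (apply Rdiv_lt_0_compat; lra).
  destruct (hconv (mkposreal _ Hd)) as [n0 Hn0]; exists n0; intros n Hn.
  specialize (Hn0 n Hn); simpl in Hn0.
  apply Rbar_le_lt_trans with (Finite (eps / 2)); [|simpl; lra].
  apply sup_on_le; intros [t x] [Hp _].
  destruct (Hb _ Hp) as [Ht Hx]; simpl fst in *; simpl snd in *.
  apply Rle_trans with (eps / (2 * (Rabs S + 1)) * S).
  - apply HS; auto using tame_plane_wave, tame_Fourier_seq; [lra|].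
    intros z; generalize (sup_on_lt _ _ _ Hn0 z I); intros Hz.
    replace (- B * Cmod z) with (- (B * Cmod z)) in Hz by ring.
    rewrite exp_Ropp in Hz; apply (Rle_div_l _ _ _ (exp_pos (B * Cmod z))), Hz.
  - apply Rle_trans with (eps / (2 * (Rabs S + 1)) * (Rabs S + 1)).
    + apply Rmult_le_compat_l; [lra|]. generalize (Rle_abs S); lra.
    + right; field; lra.
Qed.
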